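(* Let $\mathbb F_q$ be a finite field, let $A$ and $B$ be finite-dimensional $\mathbb F_q$-algebras, and let $m$ be a positive integer. If $\gcd(m,c(A)!)=1$, then $A_{\mathbb F_{q^m}}\cong B_{\mathbb F_{q^m}}$ (as $\mathbb F_{q^m}$-algebras) implies $A\cong B$ (as $\mathbb F_q$-algebras).
   Context: All algebras are associative and unital, and all algebra homomorphisms preserve the identity. For a field extension $\mathbb E/\Bbbk$ and a $\Bbbk$-algebra $A$, write $A_{\mathbb E}=\mathbb E\otimes_{\Bbbk}A$. For $\Bbbk=\mathbb F_q$ with algebraic closure $\overline{\Bbbk}$ and a finite-dimensional $\Bbbk$-algebra $A$ of dimension $n$, after choosing a basis of $A$ the group $\mathrm{Aut}(A_{\overline{\Bbbk}})$ of $\overline{\Bbbk}$-algebra automorphisms of $A_{\overline{\Bbbk}}$ is identified with the set of invertible $n\times n$ matrices over $\overline{\Bbbk}$ satisfying the polynomial equations expressing preservation of multiplication and of the identity; it is an affine algebraic group. $c(A)$ denotes the (finite) number of connected components of $\mathrm{Aut}(A_{\overline{\Bbbk}})$ in the Zariski topology. *)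

(* Defs.v *)
From HB Require Import structures.
From mathcomp Require Import all_boot all_order all_algebra all_field.
(* the notations of mpoly clash with those of classical_sets *)
From mathcomp Require Import -(notations) mpoly.
From mathcomp Require Import finmap boolp classical_sets functions cardinality.
From mathcomp Require Import topology.

Set Implicit Arguments.
Unset Strict Implicit.
Unset Printing Implicit Defensive.

Import GRing.Theory.
Local Open Scope ring_scope.
Local Open Scope classical_set_scope.

(* Associative unital finite-dimensional algebras over a field.  The library  *)
(* structure falgType requires 1 != 0; here the zero algebra is allowed.      *)
HB.mixin Record isFinDimAlgebra (F : fieldType) A of Vector F A := {
  amul : A -> A -> A;
  aone : A;
  amulA : associative amul;
  amul1l : left_id aone amul;
  amul1r : right_id aone amul;
  amul_linearl : forall y, linear (amul^~ y);
  amul_linearr : forall x, linear (amul x)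
}.

#[short(type="fdalgType")]
HB.structure Definition FinDimAlgebra (F : fieldType) :=
  { A of Vector F A & isFinDimAlgebra F A }.

Section FinDimAlgebraTheory.
Variables (F : fieldType) (A : fdalgType F).
Implicit Types x y : A.

Lemma amulDl : left_distributive (@amul F A) +%R.
Proof. by move=> x y z; have := amul_linearl z 1 x y; rewrite !scale1r. Qed.

Lemma amulDr : right_distributive (@amul F A) +%R.
Proof. by move=> x y z; have := amul_linearr x 1 y z; rewrite !scale1r. Qed.

Lemma amul0l y : amul 0 y = 0.
Proof. by apply: (addrI (amul 0 y)); rewrite -amulDl !addr0. Qed.

Lemma amul0r x : amul x 0 = 0.
Proof. by apply: (addrI (amul x 0)); rewrite -amulDr !addr0. Qed.

Lemma amulZl a x y : amul (a *: x) y = a *: amul x y.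
Proof. by have := amul_linearl y a x 0; rewrite amul0l !addr0. Qed.

Lemma amulZr a x y : amul x (a *: y) = a *: amul x y.
Proof. by have := amul_linearr x a y 0; rewrite amul0r !addr0. Qed.

Lemma amul_suml I r (P : pred I) (f : I -> A) y :
  amul (\sum_(i <- r | P i) f i) y = \sum_(i <- r | P i) amul (f i) y.
Proof.
exact: (big_morph (amul^~ y) (fun a b => amulDl a b y) (amul0l y)).
Qed.

Lemma amul_sumr I r (P : pred I) (f : I -> A) x :
  amul x (\sum_(i <- r | P i) f i) = \sum_(i <- r | P i) amul x (f i).
Proof. exact: (big_morph (amul x) (amulDr x) (amul0r x)). Qed.

End FinDimAlgebraTheory.

Section FalgebraToFinDimAlgebra.
Variables (F : fieldType) (A : falgType F).

Let mul_linearl (y : A) : linear ( *%R^~ y).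
Proof. by move=> a x z; rewrite mulrDl scalerAl. Qed.

Let mul_linearr (x : A) : linear ( *%R x).
Proof. by move=> a y z; rewrite mulrDr scalerAr. Qed.

Definition fdalg_of_falg : fdalgType F :=
  HB.pack (A : Type) (Vector.class A)
    (isFinDimAlgebra.Build F A (@mulrA A) (@mul1r A) (@mulr1 A)
       mul_linearl mul_linearr).

End FalgebraToFinDimAlgebra.

Definition is_alg_hom (F : fieldType) (A B : fdalgType F) (f : A -> B) : Prop :=
  [/\ linear f, f aone = aone & {morph f : x y / amul x y}].

Definition alg_isomorphic (F : fieldType) (A B : fdalgType F) : Prop :=
  exists f : A -> B, is_alg_hom f /\ bijective f.

(* L (x) A, realized on coordinate vectors over L with respect to the basis   *)
(* 1 (x) e_i, where (e_i) is the basis (vbasis fullv) of A.  The lemma        *)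
(* base_change_universal below is its universal property.                     *)
Definition base_change (F L : fieldType) (iota : {rmorphism F -> L})
  (A : fdalgType F) : Type := 'rV[L]_(\dim {: A}).

Section BaseChange.
Variables (F L : fieldType) (iota : {rmorphism F -> L}) (A : fdalgType F).

Local Notation n := (\dim {: A}).
Local Notation e := (vbasis {: A}).
Local Notation AL := (base_change iota A).

HB.instance Definition _ := Vector.copy AL 'rV[L]_n.

(* a |-> 1 (x) a *)
Definition base_change_in (a : A) : AL :=
  (\row_(k < n) iota (coord e k a) : 'rV[L]_n).
Local Notation inb := base_change_in.

Definition base_change_coef (x : AL) (i : 'I_n) : L := (x : 'rV[L]_n) 0 i.
Local Notation cf := base_change_coef.

Definition base_change_mul (x y : AL) : AL :=
  \sum_i \sum_j (cf x i * cf y j) *: inb (amul e`_i e`_j).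

Lemma base_change_inD a b : inb (a + b) = inb a + inb b.
Proof. by apply/(@rowP L n)=> k; rewrite !mxE !linearD /= rmorphD. Qed.

Lemma base_change_inZ c a : inb (c *: a) = iota c *: inb a.
Proof. by apply/(@rowP L n)=> k; rewrite !mxE !linearZ /= rmorphM. Qed.

Lemma base_change_in0 : inb 0 = 0.
Proof. by rewrite -(scale0r 0) base_change_inZ rmorph0 scale0r. Qed.

Lemma base_change_in_sum I r (P : pred I) (f : I -> A) :
  inb (\sum_(i <- r | P i) f i) = \sum_(i <- r | P i) inb (f i).
Proof. exact: (big_morph inb base_change_inD base_change_in0). Qed.

Lemma base_change_in_basis (i : 'I_n) :
  inb e`_i = (delta_mx 0 i : 'rV[L]_n).
Proof.
apply/(@rowP L n)=> k; rewrite !mxE coord_free ?(basis_free (vbasisP _)) //.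
by rewrite eqxx rmorph_nat eq_sym.
Qed.

Lemma base_change_sum (x : AL) : x = \sum_i cf x i *: inb e`_i.
Proof.
rewrite [LHS](row_sum_delta (x : 'rV[L]_n)); apply: eq_bigr=> i _.
by rewrite base_change_in_basis.
Qed.

Let cfD x y i : cf (x + y) i = cf x i + cf y i. Proof. by rewrite /cf mxE. Qed.
Let cfZ a x i : cf (a *: x) i = a * cf x i. Proof. by rewrite /cf mxE. Qed.

Let mulDl : left_distributive base_change_mul +%R.
Proof.
move=> x y z; rewrite /base_change_mul -big_split; apply: eq_bigr=> i _ /=.
by rewrite -big_split; apply: eq_bigr=> j _; rewrite cfD mulrDl scalerDl.
Qed.

Let mulDr : right_distributive base_change_mul +%R.
Proof.
move=> x y z; rewrite /base_change_mul -big_split; apply: eq_bigr=> i _ /=.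
by rewrite -big_split; apply: eq_bigr=> j _; rewrite cfD mulrDr scalerDl.
Qed.

Let mulZl a x y : a *: base_change_mul x y = base_change_mul (a *: x) y.
Proof.
rewrite /base_change_mul scaler_sumr; apply: eq_bigr=> i _.
by rewrite scaler_sumr; apply: eq_bigr=> j _; rewrite scalerA cfZ mulrA.
Qed.

Let mulZr a x y : a *: base_change_mul x y = base_change_mul x (a *: y).
Proof.
rewrite /base_change_mul scaler_sumr; apply: eq_bigr=> i _.
by rewrite scaler_sumr; apply: eq_bigr=> j _; rewrite scalerA cfZ mulrCA.
Qed.

Let mul0l x : base_change_mul 0 x = 0.
Proof. by apply: (addrI (base_change_mul 0 x)); rewrite -mulDl !addr0. Qed.

Let mul0r x : base_change_mul x 0 = 0.
Proof. by apply: (addrI (base_change_mul x 0)); rewrite -mulDr !addr0. Qed.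

Let mul_suml I r (P : pred I) (f : I -> AL) y :
  base_change_mul (\sum_(i <- r | P i) f i) y =
  \sum_(i <- r | P i) base_change_mul (f i) y.
Proof.
exact: (big_morph (base_change_mul^~ y) (fun a b => mulDl a b y) (mul0l y)).
Qed.

Let mul_sumr I r (P : pred I) (f : I -> AL) x :
  base_change_mul x (\sum_(i <- r | P i) f i) =
  \sum_(i <- r | P i) base_change_mul x (f i).
Proof. exact: (big_morph (base_change_mul x) (mulDr x) (mul0r x)). Qed.

Let in_mul a b : inb (amul a b) = base_change_mul (inb a) (inb b).
Proof.
rewrite {1}(coord_vbasis (memvf a)) {1}(coord_vbasis (memvf b)).
rewrite amul_suml base_change_in_sum; apply: eq_bigr=> i _.
rewrite amulZl amul_sumr base_change_inZ base_change_in_sum scaler_sumr.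
apply: eq_bigr=> j _; rewrite amulZr base_change_inZ scalerA.
by rewrite /cf !mxE.
Qed.

Let mulA : associative base_change_mul.
Proof.
move: mul_suml mul_sumr mulZl mulZr in_mul; rewrite /associative.
move: base_change_mul => M Ml Mr MZl MZr Min x y z.
rewrite (base_change_sum x) !Ml; apply: eq_bigr=> i _.
rewrite -!MZl; congr (_ *: _).
rewrite (base_change_sum y) Ml !Mr Ml; apply: eq_bigr=> j _.
rewrite -MZr -!MZl -MZr; congr (_ *: _).
rewrite (base_change_sum z) !Mr; apply: eq_bigr=> k _.
by rewrite -!MZr -!Min amulA.
Qed.

Let mul1l : left_id (inb aone) base_change_mul.
Proof.
move=> x; rewrite (base_change_sum x) mul_sumr; apply: eq_bigr=> i _.
by rewrite -mulZr -in_mul amul1l.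
Qed.

Let mul1r' : right_id (inb aone) base_change_mul.
Proof.
move=> x; rewrite (base_change_sum x) mul_suml; apply: eq_bigr=> i _.
by rewrite -mulZl -in_mul amul1r.
Qed.

Let mul_linearl y : linear (base_change_mul^~ y).
Proof. by move=> a x z; rewrite mulDl mulZl. Qed.

Let mul_linearr x : linear (base_change_mul x).
Proof. by move=> a y z; rewrite mulDr mulZr. Qed.

HB.instance Definition _ :=
  isFinDimAlgebra.Build L AL mulA mul1l mul1r' mul_linearl mul_linearr.

Lemma base_change_inM a b : inb (amul a b) = amul (inb a) (inb b).
Proof. exact: in_mul. Qed.

Lemma base_change_in1 : inb aone = aone.
Proof. by []. Qed.

Lemma base_change_universal (C : fdalgType L) (f : A -> C) :
    (forall c a b, f (c *: a + b) = iota c *: f a + f b) ->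
    f aone = aone -> {morph f : x y / amul x y} ->
  exists! g : AL -> C, is_alg_hom g /\ g \o inb =1 f.
Proof.
move=> fl f1 fM; pose g (x : AL) := \sum_i cf x i *: f e`_i.
have gl : linear g.
  move=> a x y; rewrite /g scaler_sumr -big_split; apply: eq_bigr=> i _.
  by rewrite cfD cfZ scalerDl scalerA.
have fD a b : f (a + b) = f a + f b.
  by have := fl 1 a b; rewrite rmorph1 !scale1r.
have f0 : f 0 = 0 by apply: (addrI (f 0)); rewrite -fD !addr0.
have fZ c a : f (c *: a) = iota c *: f a by have := fl c a 0; rewrite f0 !addr0.
have gE a : g (inb a) = f a.
  rewrite [in RHS](coord_vbasis (memvf a)) (big_morph f fD f0).
  by apply: eq_bigr=> i _; rewrite fZ /cf !mxE.
have linE (h : AL -> C) : linear h ->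
    forall x, h x = \sum_i cf x i *: h (inb e`_i).
  move=> hl x.
  have hD u v : h (u + v) = h u + h v by have := hl 1 u v; rewrite !scale1r.
  have h0 : h 0 = 0 by apply: (addrI (h 0)); rewrite -hD !addr0.
  have hZ a u : h (a *: u) = a *: h u by have := hl a u 0; rewrite h0 !addr0.
  by rewrite {1}(base_change_sum x) (big_morph h hD h0); apply: eq_bigr.
have gD x y : g (x + y) = g x + g y by have := gl 1 x y; rewrite !scale1r.
have g0 : g 0 = 0 by apply: (addrI (g 0)); rewrite -gD !addr0.
have gZ a u : g (a *: u) = a *: g u by have := gl a u 0; rewrite g0 !addr0.
exists g; split.
  split=> //; split=> //; first by rewrite -base_change_in1 gE.
  move=> x y; rewrite [amul x y]/(base_change_mul x y) /base_change_mul.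
  rewrite (big_morph g gD g0) {2}/g amul_suml; apply: eq_bigr=> i _.
  rewrite (big_morph g gD g0) amulZl {2}/g amul_sumr scaler_sumr.
  by apply: eq_bigr=> j _; rewrite gZ gE fM amulZr scalerA.
move=> h [[hl _ _] hE]; apply/funext=> x; rewrite (linE h hl).
by apply: eq_bigr=> i _; rewrite -[h _]/((h \o inb) _) hE.
Qed.

End BaseChange.

(* The affine space K^N with its Zariski topology. *)
Definition affine_space (K : closedFieldType) (N : nat) : Type := 'rV[K]_N.

Section Zariski.
Variables (K : closedFieldType) (N : nat).
Local Notation AN := (affine_space K N).

HB.instance Definition _ := Choice.copy AN 'rV[K]_N.

Definition zero_locus (S : set (mpoly N K)) : set AN :=
  [set x | forall p, S p -> meval (fun i => (x : 'rV[K]_N) 0 i) p = 0].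

Definition zariski_open (U : set AN) : Prop :=
  exists S, ~` U = zero_locus S.

Let zariski_openT : zariski_open setT.
Proof.
exists [set (1 : mpoly N K)]; rewrite setCT; apply/seteqP; split=> // x /(_ 1 erefl).
by rewrite meval1 => /eqP; rewrite oner_eq0.
Qed.

Let zariski_openI : setI_closed zariski_open.
Proof.
move=> U V [S US] [T VT].
exists [set p | exists2 s, S s & exists2 t, T t & p = s * t].
rewrite setCI US VT; apply/seteqP; split=> x.
  by case=> Zx p [s Ss [t Tt ->]]; rewrite mevalM;
    [rewrite (Zx _ Ss) mul0r | rewrite (Zx _ Tt) mulr0].
move=> Zx; have [ZS|/existsNP[s /not_implyP[Ss sx]]] := pselect (zero_locus S x).
  by left.
right=> t Tt; have /eqP := Zx (s * t) (ex_intro2 _ _ s Ss (ex_intro2 _ _ t Tt erefl)).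
by rewrite mevalM mulf_eq0 => /orP[/eqP/sx|/eqP].
Qed.

Let zariski_open_bigU (I : Type) (f : I -> set AN) :
  (forall i, zariski_open (f i)) -> zariski_open (\bigcup_i f i).
Proof.
move=> fo; exists [set p | exists2 S, S p & exists i, ~` f i = zero_locus S].
rewrite setC_bigcup; apply/seteqP; split=> x.
  move=> fx p [S Sp [i fS]]; suff: zero_locus S x by apply.
  by rewrite -fS; exact: fx.
move=> Zx i _; have [S fS] := fo i; rewrite fS => p Sp.
by apply: Zx; exists S => //; exists i.
Qed.

HB.instance Definition _ :=
  isOpenTopological.Build AN zariski_openT zariski_openI zariski_open_bigU.

Lemma zariski_closedE (Z : set AN) : closed Z <-> exists S, Z = zero_locus S.
Proof.
rewrite -openC; split=> [[S]|[S ZS]]; first by rewrite setCK; exists S.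
by exists S; rewrite setCK.
Qed.

End Zariski.

(* Matrices of the algebra automorphisms of K (x) A; matrices act on row      *)
(* vectors on the right.                                                      *)
Definition aut_mx (F : fieldType) (K : closedFieldType)
    (iota : {rmorphism F -> K}) (A : fdalgType F) : set 'M[K]_(\dim {: A}) :=
  [set g | [/\ g \in unitmx,
      forall x y : base_change iota A,
        amul x y *m g
        = amul (x *m g : base_change iota A) (y *m g : base_change iota A)
      & (aone : base_change iota A) *m g = aone :> base_change iota A]].

Arguments aut_mx {F K} iota A _.

Definition Aut (F : fieldType) (K : closedFieldType)
    (iota : {rmorphism F -> K}) (A : fdalgType F) :
    set (affine_space K (\dim {: A} * \dim {: A})) :=
  [set mxvec g | g in aut_mx iota A].

Arguments Aut {F K} iota A _.

(* c(A): the number of connected components of Aut.  The value is 0 in case   *)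
(* there are infinitely many, which never happens.                            *)
Definition num_components (F : fieldType) (K : closedFieldType)
    (iota : {rmorphism F -> K}) (A : fdalgType F) : nat :=
  #|` fset_set [set connected_component (Aut iota A) g | g in Aut iota A]|.

(* Main.v *)
From HB Require Import structures.
Require Import Defs.
From mathcomp Require Import all_boot all_order all_algebra all_field.
From mathcomp Require Import -(notations) mpoly.
From mathcomp Require Import finmap boolp classical_sets functions cardinality.
From mathcomp Require Import topology.

Set Implicit Arguments.
Unset Strict Implicit.
Unset Printing Implicit Defensive.

Import Order.TTheory GRing.Theory.
Local Open Scope ring_scope.

(** Let q be the order of F, let phi be the map x |-> x ^ q on K, and let C be
    the matrix of structure constants of A.  A matrix x in GL_n(K) carrying a
    second matrix D of structure constants over F to C determines
    a = x^-1 phi(x), and since phi fixes C and D, this a is an automorphism of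
    A_K.  Say that a comes from the form D.

    Every automorphism a comes from some form: the equation phi(x) = x a has an
    invertible solution [lang_GL], and transporting C along x^-1 gives a
    phi-invariant, hence F-rational, D [cocycle_ex].  Two forms from which the
    same a comes are isomorphic over F [cocycle_inj].  So Aut(A_K) is the
    disjoint union of classes indexed by the isomorphism classes of forms, and
    there are finitely many of these because F is finite.

    The main point is that every class is closed in Aut(A_K).  The entries
    of x satisfy x_ij ^ q = sum_k x_ik a_kj, so K[x] is spanned over K[a] by the
    monomials with all exponents below q: the map x |-> x^-1 phi(x) is finite,
    and a finite map is closed.  Concretely, an a0 outside the image of a closed
    set is separated from this image by the determinant of a multiplication
    matrix [separate_from_image, cocycle_separation].  A partition into finitely
    many closed classes is a partition into open and closed ones, so a connected
    subset of Aut(A_K) lies in one class [connected_cocycle].  This gives what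
    the theorem of Lang gives for the identity component, and avoids dimension
    theory.

    Now let B become isomorphic to A over the extension E of degree m.  Embed E
    in K; the isomorphism is a matrix u with phi^m(u) = u, and the automorphism
    a = u^-1 phi(u) comes from the form B.  The continuous map
    T(g) = a phi(g) sends Aut(A_K) to itself, so it acts on the set of its
    connected components, and T^m(1) = u^-1 phi^m(u) = 1.  The component of 1 is
    therefore periodic; its period divides m and is at most c(A), so it is 1
    because m is prime to c(A)! [periodic_fixed_point].  Hence T(1) = a lies in
    the component of 1.  As 1 comes from the form A, so does a, and A and B are
    isomorphic [descent].

    That c(A) really counts the components requires their number to be finite
    [finite_components]; this follows from the descending chain condition on
    Zariski closed sets, which is deduced from the lemma of Dickson. *)

(** * The equation phi(x) = x l in the general linear group *)

Section LangGL.
Variables (K : closedFieldType) (q : nat) (phi : {rmorphism K -> K}).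
Hypotheses (q_gt1 : (1 < q)%N) (phiE : forall x, phi x = x ^+ q).

Lemma artin_schreier (c : K) : exists t, t ^+ q = t + c.
Proof.
case: q q_gt1 => [|[|k]] // _.
have [t tE] :=
  @solve_monicpoly K k.+2 (fun i => (i == 0%N)%:R * c + (i == 1%N)%:R) isT.
exists t; rewrite tE 2!big_ord_recl big1 /= ?addr0 => [|i _].
  by rewrite expr0 expr1 !mul1r mul0r !mulr1 add0r mul1r addrC.
by rewrite !mul0r.
Qed.

(** Eliminating y 0, ..., y (s - 1) leaves one equation Q(t) = t for t = y s,
    where Q is a nonzero combination of the powers t ^ (q ^ j) with j > 0.
    Hence X ^ 2 divides Q, and Q(t) = t has a root besides 0. *)
Lemma additive_poly_root (s : nat) (c : nat -> K) :
    (exists2 i, (i <= s)%N & c i != 0) ->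
  exists y : nat -> K, [/\ y s != 0, y 0%N = c 0%N * y s ^+ q &
    forall i, (i < s)%N -> y i.+1 = y i ^+ q + c i.+1 * y s ^+ q].
Proof.
move=> [i0 i0s ci0].
pose Q := fix Q i : {poly K} :=
  if i is j.+1 then Q j ^+ q + (c i)%:P * 'X^q else (c 0%N)%:P * 'X^q.
(* The coefficient of X ^ q in Q i is c i, and all other terms have higher
   degree. *)
have QE i : exists Y, Q i = 'X^q * ((c i)%:P + 'X * Y).
  elim: i => [|i [Y QY]] /=; first by exists 0; rewrite mulr0 addr0 mulrC.
  have [k qk] : exists k, q = k.+2 by case: (q) q_gt1 => [|[|k]] // _; exists k.
  exists ('X^(q * q - q.+1) * ((c i)%:P + 'X * Y) ^+ q).
  rewrite {}QY exprMn -exprM mulrDr addrC [_%:P * _]mulrC; congr (_ + _).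
  rewrite !mulrA -exprSr -exprD; congr ('X^_ * _).
  by rewrite subnKC // qk ltn_Pmulr.
have Q0 i : c i != 0 -> Q i != 0.
  have [Y ->] := QE i; move=> ci.
  rewrite mulf_neq0 ?(monic_neq0 (monicXn _ _)) //.
  apply: contraNneq ci => /(congr1 (fun p : {poly K} => p.[0])).
  by rewrite !hornerE => ->.
have Qs : Q s != 0.
  suff /(_ (s - i0)%N) : forall d, (i0 + d <= s)%N -> Q (i0 + d)%N != 0.
    by rewrite subnKC // => ->.
  elim=> [|d IH] ds; first by rewrite addn0 Q0.
  have [c0|/Q0//] := eqVneq (c (i0 + d.+1)%N) 0.
  by rewrite addnS in ds c0 *;
    rewrite /= c0 mul0r addr0 expf_neq0 // IH // ltnW.
have [S QS] : exists S, Q s = 'X * ('X * S).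
  have [Y ->] := QE s; exists ('X^(q - 2) * ((c s)%:P + 'X * Y)).
  by rewrite !mulrA -expr2 -exprD subnKC.
have [t tS] : exists t, t * S.[t] = 1.
  have S0 : S != 0 by apply: contraNneq Qs => S0; rewrite QS S0 !mulr0.
  have /closed_rootP[t /rootP] : size ('X * S - 1) != 1%N.
    have sizeXS : size ('X * S) = (size S).+1 by rewrite mulrC size_mulX.
    by rewrite size_polyDl sizeXS ?eqSS ?size_poly_eq0 // size_polyN size_poly1
      ltnS size_poly_gt0.
  by rewrite !hornerE => /eqP; rewrite subr_eq0 => /eqP tS; exists t.
have Qt : (Q s).[t] = t by rewrite QS 2!hornerM !hornerX tS mulr1.
exists (fun i => (Q i).[t]); rewrite Qt; split=> [||i _] /=;
  rewrite ?hornerE //.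
by apply: contra_eq_neq tS => ->; rewrite mul0r eq_sym oner_eq0.
Qed.

(** Iterate the semilinear map psi(v) = phi(v) l^-1 on a vector until the first
    linear dependency v_(s+1) = sum_i c_i v_i.  The condition that
    w = sum_i y_i v_i be fixed by psi is the system of [additive_poly_root], and
    w is nonzero because y_s is nonzero and the dependency is the first one. *)
Lemma frobenius_eigenvector n (l : 'M[K]_n.+1) : l \in unitmx ->
  exists2 v : 'rV_n.+1, v != 0 & map_mx phi v = v *m l.
Proof.
move=> lU; pose psi (v : 'rV[K]_n.+1) := map_mx phi v *m invmx l.
pose v i : 'rV_n.+1 := iter i psi (const_mx 1).
pose V r := \matrix_(i < r) v i.
have V_sub r : (V r <= V r.+1)%MS.
  apply/row_subP=> i; rewrite rowK.
  have -> : v i = row (widen_ord (leqnSn r) i) (V r.+1) by rewrite rowK.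
  exact: row_sub.
have [r0 r0P] : exists r, (v r <= V r)%MS.
  apply: contrapT => /forallNP noP.
  (* Without any dependency the rank of V r would grow with r without bound. *)
  have rk r : (r <= \rank (V r))%N.
    elim: r => // r /leq_ltn_trans; apply; rewrite ltnNge; apply/negP=> rkle.
    apply: (noP r); have /mxrank_leqif_eq[_ eqV] := V_sub r.
    have : (\rank (V r) == \rank (V r.+1)) by rewrite eqn_leq rkle mxrankS.
    rewrite eqV => /eqmxP ->;
      have -> : v r = row ord_max (V r.+1) by rewrite rowK.
    exact: row_sub.
  by have := leq_trans (rk n.+2) (rank_leq_col _); rewrite ltnn.
have [r vr min_r] := ex_minnP (ex_intro (fun r => (v r <= V r)%MS) r0 r0P).
case: r vr min_r => [|s] vs min_s.
  have [d vd] := submxP vs; move: vd;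
    rewrite [d]thinmx0 mul0mx => /rowP /(_ 0) /eqP.
  by rewrite !mxE oner_eq0.
have vpos i : v i != 0.
  elim: i => [|i IH]; first by apply/eqP=> /rowP /(_ 0) /eqP;
    rewrite !mxE oner_eq0.
  apply: contraNneq IH => /(congr1 (mulmx^~ l)).
  by rewrite mulmxKV // mul0mx => /eqP; rewrite map_mx_eq0.
have [c vsE] := submxP vs.
pose c' i := if insub i is Some j then c 0 (j : 'I_s.+1) else 0.
have c'E (i : 'I_s.+1) : c' i = c 0 i by rewrite /c' insubT //= => H;
  congr (c _ _); apply/val_inj.
have vsS : v s.+1 = \sum_(i < s.+1) c' i *: v i.
  by rewrite vsE mulmx_sum_row; apply: eq_bigr=> i _; rewrite rowK c'E.
have [i i_le ci] : exists2 i, (i <= s)%N & c' i != 0.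
  have [/forallP c0|] := boolP [forall i : 'I_s.+1, c' i == 0].
    case/eqP: (vpos s.+1); rewrite vsS big1 // => i _.
    by rewrite (eqP (c0 i)) scale0r.
  by rewrite negb_forall => /existsP[i ci]; exists i; rewrite // -ltnS.
have [y [ys0 y0 yS]] := additive_poly_root (ex_intro2 _ _ i i_le ci).
pose w := \sum_(i < s.+1) y i *: v i.
have psiw : psi w = w.
  rewrite /psi /w raddf_sum /= mulmx_suml.
  transitivity (\sum_(i < s.+1) y i ^+ q *: v i.+1).
    by apply: eq_bigr=> j _; rewrite map_mxZ /= -scalemxAl phiE.
  rewrite big_ord_recr /= -[psi (iter s _ _)]/(v s.+1) vsS scaler_sumr
    big_ord_recl [RHS]big_ord_recl /=.
  rewrite addrCA y0 scalerA mulrC; congr (_ + _).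
  rewrite -big_split; apply: eq_bigr=> j _.
  by rewrite /= /bump leq0n add1n yS // scalerDl scalerA [y s ^+ q * _]mulrC.
exists w; last by rewrite -[in RHS]psiw mulmxKV.
apply/negP=> /eqP w0; suff : (s.+1 <= s)%N by rewrite ltnn.
apply: min_s; rewrite -(eqmx_scale _ ys0).
move: w0; rewrite /w big_ord_recr /= addrC => /eqP; rewrite addr_eq0 => /eqP->.
rewrite eqmx_opp summx_sub // => j _; rewrite scalemx_sub //.
have -> : v j = row j (V s) by rewrite rowK.
exact: row_sub.
Qed.

(** Induction on n: after a change of basis that puts a fixed vector first,
    l is block triangular with a corner 1; the remaining diagonal block is
    treated by induction and the off-diagonal one by [artin_schreier]. *)
Theorem lang_GL n (l : 'M[K]_n) : l \in unitmx ->
  exists2 x : 'M_n, x \in unitmx & map_mx phi x = x *m l.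
Proof.
elim: n l => [|n IH] l lU.
  by exists 1%:M; rewrite ?unitmx1 // [LHS]flatmx0 [RHS]flatmx0.
have [v v0 vl] := frobenius_eigenvector lU.
have [g gU gv] : exists2 g : 'M[K]_(1 + n), g \in unitmx & usubmx g = v.
  have rkv : \rank v = 1%N by apply/eqP;
    rewrite eqn_leq rank_leq_row lt0n mxrank_eq0.
  have /submxP[a va] : (v <= usubmx (row_ebase v : 'M_(1 + n)))%MS.
    pose e := row_ebase v : 'M_(1 + n).
    have vE : v =
      col_ebase v *m (row_mx 1%:M 0 *m col_mx (usubmx e) (dsubmx e)).
      by rewrite -pid_mx_row vsubmxK -{1}(mulmx_ebase v) rkv mulmxA.
    by rewrite {1}vE mul_row_col mul0mx addr0 mul1mx submxMl.
  have a0 : a 0 0 != 0.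
    apply: contraNneq v0 => a0; rewrite va [a]mx11_scalar a0.
    by rewrite mul_scalar_mx scale0r.
  exists (a 0 0 *: row_ebase v);
    first by rewrite unitmxZ ?unitfE // row_ebase_unit.
  by rewrite [LHS]linearZ /= [RHS]va [a in RHS]mx11_scalar mul_scalar_mx.
have pgU : map_mx phi g \in unitmx by rewrite map_unitmx.
pose l' : 'M_(1 + n) := g *m l *m invmx (map_mx phi g).
have l'U : l' \in unitmx by rewrite !unitmx_mul gU lU unitmx_inv.
have l'u : usubmx l' = row_mx 1%:M 0.
  rewrite /l' -mulmxA -mul_usub_mx gv mulmxA -vl -gv map_usubmx mul_usub_mx
    mulmxV //.
  by rewrite (@scalar_mx_block _ 1 n) block_mxEv col_mxKu.
have l'E : l' = block_mx 1%:M 0 (dlsubmx l') (drsubmx l').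
  by rewrite block_mxEv -l'u hsubmxK vsubmxK.
have [|x'' x''U x''l] := IH (drsubmx l').
  by move: l'U; rewrite l'E !unitmxE det_lblock det1 mul1r block_mxKdr.
have [y yE] : exists y, map_mx phi y = y + x'' *m dlsubmx l'.
  have [f fE] := choice (fun i => artin_schreier ((x'' *m dlsubmx l') i 0)).
  exists (\col_i f i); apply/colP=> i; rewrite mxE [in RHS]mxE mxE phiE fE.
  by congr (_ + _); rewrite mxE.
pose x' : 'M_(1 + n) := block_mx 1%:M 0 y x''.
have x'U : x' \in unitmx by rewrite unitmxE det_lblock det1 mul1r -unitmxE.
have x'l : map_mx phi x' = x' *m l'.
  rewrite /x' map_block_mx l'E mulmx_block map_mx1 map_mx0 !mul1mx !mul0mx
    !mulmx1 !mulmx0.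
  by rewrite !addr0 yE x''l add0r.
exists (x' *m g); first by rewrite unitmx_mul x'U.
by rewrite map_mxM x'l /l' !mulmxA mulmxKV.
Qed.

End LangGL.

(** * Polynomial functions and finiteness of the Frobenius cover *)

Section PolynomialFunctions.
Variables (K : fieldType) (N : nat).
Implicit Types (f g : 'rV[K]_N -> K).

Definition polyfun f := exists p : mpoly N K, forall x, f x = meval (x 0) p.

Lemma polyfun_eq f g : f =1 g -> polyfun f -> polyfun g.
Proof. by move=> fg [p fp]; exists p => x; rewrite -fg. Qed.

Lemma polyfun_cst c : polyfun (fun=> c).
Proof. by exists (mpolyC N c) => x; rewrite mevalC. Qed.

Lemma polyfun_coord i : polyfun (fun x => x 0 i).
Proof. by exists (mpolyX K (mnm1 i)) => x; rewrite mevalXU. Qed.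

Lemma polyfunD f g : polyfun f -> polyfun g -> polyfun (fun x => f x + g x).
Proof. by move=> [p fp] [r gr]; exists (p + r) => x; rewrite mevalD fp gr. Qed.

Lemma polyfunM f g : polyfun f -> polyfun g -> polyfun (fun x => f x * g x).
Proof. by move=> [p fp] [r gr]; exists (p * r) => x; rewrite mevalM fp gr. Qed.

Lemma polyfunB f g : polyfun f -> polyfun g -> polyfun (fun x => f x - g x).
Proof. by move=> [p fp] [r gr]; exists (p - r) => x; rewrite mevalB fp gr. Qed.

Lemma polyfunX f k : polyfun f -> polyfun (fun x => f x ^+ k).
Proof.
move=> pf; elim: k => [|k IH]; first exact: polyfun_cst.
by apply: polyfun_eq (polyfunM pf IH) => x; rewrite exprS.
Qed.

Lemma polyfun_sum I (r : seq I) (P : pred I) (F : I -> 'rV[K]_N -> K) :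
  (forall i, P i -> polyfun (F i)) ->
    polyfun (fun x => \sum_(i <- r | P i) F i x).
Proof.
move=> pF; elim: r => [|i r IH].
  by apply: polyfun_eq (polyfun_cst 0) => x; rewrite big_nil.
case Pi: (P i); last by apply: polyfun_eq IH => x; rewrite big_cons Pi.
by apply: polyfun_eq (polyfunD (pF i Pi) IH) => x; rewrite big_cons Pi.
Qed.

Lemma polyfun_prod I (r : seq I) (P : pred I) (F : I -> 'rV[K]_N -> K) :
  (forall i, P i -> polyfun (F i)) ->
    polyfun (fun x => \prod_(i <- r | P i) F i x).
Proof.
move=> pF; elim: r => [|i r IH].
  by apply: polyfun_eq (polyfun_cst 1) => x; rewrite big_nil.
case Pi: (P i); last by apply: polyfun_eq IH => x; rewrite big_cons Pi.
by apply: polyfun_eq (polyfunM (pF i Pi) IH) => x; rewrite big_cons Pi.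
Qed.

Lemma polyfun_det n (M : 'rV[K]_N -> 'M[K]_n) :
  (forall i j, polyfun (fun x => M x i j)) -> polyfun (fun x => \det (M x)).
Proof.
move=> pM; rewrite /determinant; apply: polyfun_sum => s _.
by apply: polyfunM; [exact: polyfun_cst|apply: polyfun_prod].
Qed.

Lemma lagrange_polyfun k (pt : 'I_k -> 'rV[K]_N) : injective pt ->
  forall i, exists2 f, polyfun f & forall j, f (pt j) = (i == j)%:R.
Proof.
move=> pt_inj i.
have sep j : exists f, polyfun f /\ (j != i -> f (pt i) = 1 /\ f (pt j) = 0).
  have [->|ji] := eqVneq j i; first by exists (fun=> 0); split=> //;
    exact: polyfun_cst.
  have [c cij] : exists c, pt i 0 c != pt j 0 c.
    apply/existsP; rewrite -negb_forall; apply: contra ji => /forallP eqij.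
    by apply/eqP/pt_inj/rowP=> c; rewrite (eqP (eqij c)).
  exists (fun x => (x 0 c - pt j 0 c) / (pt i 0 c - pt j 0 c)); split=> [|_].
    apply: polyfunM (polyfun_cst _).
    by apply: polyfunB; [exact: polyfun_coord|exact: polyfun_cst].
  by rewrite divff ?subr_eq0 // subrr mul0r.
have [f fP] := choice sep.
exists (fun x => \prod_(j | j != i) f j x).
  by apply: polyfun_prod => j _; have [] := fP j.
move=> j; have [<-|ij] := eqVneq i j.
  by rewrite big1 // => j' /(proj2 (fP j'))[].
rewrite eq_sym in ij; rewrite (bigD1 j) //=.
by have [_ /(_ ij)[_ ->]] := fP j; rewrite mul0r.
Qed.

End PolynomialFunctions.

Section FrobeniusCover.
Variables (K : fieldType) (q N s : nat).
Hypothesis q_gt1 : (1 < q)%N.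
Variable c : 'I_N -> 'I_N -> 'rV[K]_s -> K.
Hypothesis pc : forall i k, polyfun (c i k).
Implicit Types (x : 'rV[K]_N) (l : 'rV[K]_s).

(** With l fixed these equations define a finite scheme over K in the variables
    x: there are N of them, and the monomials with exponents below q span its
    coordinate ring. *)
Definition frob_rel l x := forall i, x 0 i ^+ q = \sum_k c i k l * x 0 k.

Local Notation exps := {ffun 'I_N -> 'I_q}.

Let mono x (e : 'I_N -> nat) := \prod_i x 0 i ^+ e i.

(** [F] lies in the K[l]-module spanned by the monomials in x with all exponents
    below q, modulo the equations [frob_rel].  All polynomials in x and l turn
    out to be of this kind, so the projection to the variables l is finite. *)
Definition reducible (F : 'rV[K]_N -> 'rV[K]_s -> K) :=
  exists r : exps -> 'rV[K]_s -> K, (forall a, polyfun (r a)) /\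
    forall l x, frob_rel l x -> F x l = \sum_a r a l * \prod_i x 0 i ^+ a i.

Lemma reducible_eq F G : (forall l x, frob_rel l x -> F x l = G x l) ->
  reducible F -> reducible G.
Proof.
by move=> FG [r [pr rF]]; exists r; split=> // l x lx; rewrite -FG // rF.
Qed.

Lemma reducible_sum I (t : seq I) (F : I -> 'rV[K]_N -> 'rV[K]_s -> K) :
  (forall i, reducible (F i)) -> reducible (fun x l => \sum_(i <- t) F i x l).
Proof.
move=> redF; have [r rP] := choice redF.
exists (fun a l => \sum_(i <- t) r i a l); split=> [a|l x lx].
  by apply: polyfun_sum => i _; have [] := rP i.
under [RHS]eq_bigr do rewrite mulr_suml.
rewrite exchange_big; apply: eq_bigr => i _.
by have [_ ->] := rP i.
Qed.

Lemma reducible_scale g F : polyfun g -> reducible F ->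
  reducible (fun x l => g l * F x l).
Proof.
move=> pg [r [pr rF]]; exists (fun a l => g l * r a l); split=> [a|l x lx].
  exact: polyfunM.
by rewrite rF // mulr_sumr; apply: eq_bigr => a _; rewrite mulrA.
Qed.

(** Replacing a factor x_i ^ q by a linear form lowers the total degree because
    q > 1. *)
Lemma reducible_mono e : reducible (fun x l => mono x e).
Proof.
have [d] := ubnP (\sum_i e i)%N; elim: d e => // d IH e ed.
have [/forallP e_small|] := boolP [forall i, (e i < q)%N].
  exists (fun a l => (a == [ffun i => Ordinal (e_small i)])%:R).
  split=> [a|l x lx]; first exact: polyfun_cst.
  rewrite (bigD1 [ffun i => Ordinal (e_small i)]) //= eqxx mul1r.
  rewrite [X in _ + X]big1 ?addr0 => [|a /negPf->]; last by rewrite mul0r.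
  by apply: eq_bigr => i _; rewrite ffunE.
rewrite negb_forall => /existsP[i]; rewrite -leqNgt => qi.
(* e' removes x_i ^ q from the monomial, and e'' k multiplies the rest by
   x_k. *)
pose e' j := (if j == i then e i - q else e j)%N.
have sum_e' : (\sum_j e j = q + \sum_j e' j)%N.
  rewrite (bigD1 i) //= [in RHS](bigD1 i) //= /e' eqxx addnA subnKC //.
  by congr addn; apply: eq_bigr => j /negPf->.
pose e'' k j := (e' j + (j == k))%N.
apply: (@reducible_eq (fun x l => \sum_k c i k l * mono x (e'' k))) =>
  [l x lx|].
  transitivity (x 0 i ^+ q * mono x e').
    rewrite lx mulr_suml; apply: eq_bigr => k _; rewrite -mulrA; congr (_ * _).
    rewrite /mono (bigD1 k) //= [in RHS](bigD1 k) //=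
      /e'' eqxx addn1 exprS mulrA.
    by congr (_ * _); apply: eq_bigr => j /negPf->; rewrite addn0.
  rewrite /mono (bigD1 i) //= [in RHS](bigD1 i) //=
    /e' eqxx mulrA -exprD subnKC //.
  by congr (_ * _); apply: eq_bigr => j /negPf->.
apply: reducible_sum => k; apply: reducible_scale => //; apply: IH.
have -> : (\sum_j e'' k j = (\sum_j e' j).+1)%N.
  rewrite big_split /= -addn1; congr addn.
  by rewrite (bigD1 k) //= eqxx big1 // => j /negPf->.
rewrite sum_e' ltnS in ed; apply: leq_trans ed.
exact: (leq_add q_gt1 (leqnn (\sum_j e' j)%N)).
Qed.

Lemma reducible_cst g : polyfun g -> reducible (fun x l => g l).
Proof.
move=> pg;
  apply: (@reducible_eq (fun x l => g l * mono x (fun=> 0%N))) => [l x _|].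
  by rewrite /mono big1 ?mulr1.
exact/reducible_scale/reducible_mono.
Qed.

Lemma reducible_polyfun f : polyfun f -> reducible (fun x l => f x).
Proof.
move=> [p fp].
apply: (@reducible_eq
  (fun x l => \sum_(m <- msupp p) mcoeff m p * mono x m)) => [l x _|].
  by rewrite fp mevalE.
apply: reducible_sum => m; apply: reducible_scale (reducible_mono _).
exact: polyfun_cst.
Qed.

Lemma reducibleM F G : reducible F -> reducible G ->
  reducible (fun x l => F x l * G x l).
Proof.
move=> [r [pr rF]] [t [pt tG]].
apply: (@reducible_eq (fun x l => \sum_a \sum_b
    (r a l * t b l) * mono x (fun i => a i + b i)%N)) => [l x lx|].
  rewrite rF // tG // mulr_suml; apply: eq_bigr => a _.
  rewrite mulr_sumr; apply: eq_bigr => b _; rewrite mulrACA; congr (_ * _).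
  by rewrite -big_split; apply: eq_bigr => i _; rewrite exprD.
do 2!apply: reducible_sum => ?; apply: reducible_scale (reducible_mono _).
exact: polyfunM.
Qed.

Lemma reducibleB F G : reducible F -> reducible G ->
  reducible (fun x l => F x l - G x l).
Proof.
move=> [r [pr rF]] [t [pt tG]].
exists (fun a l => r a l - t a l); split=> [a|l x lx]; first exact: polyfunB.
by rewrite rF // tG // -sumrB; apply: eq_bigr => a _; rewrite mulrBl.
Qed.

(** Closedness of the image, under the finite projection to l, of the set where
    all [Fs] vanish.  The hypothesis on [pt] says that the fibre over [l0] has
    q ^ N distinct points, as many as there are reduced monomials,
    so that the coordinate ring of the fibre is the ring of functions on it.

    Interpolation gives a combination F of the [Fs] that is 1 at every point of
    the fibre over [l0].  Let M(l) be the matrix of multiplication by F on the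
    reduced monomials.  Where all [Fs] vanish at some x above l, the vector of
    monomials of x is a nonzero kernel vector of M(l), so det M(l) = 0.  Over
    [l0] the evaluation matrix E of the monomials at the points satisfies
    E M(l0)^T = E and is invertible, so M(l0) = 1. *)
Theorem separate_from_image (l0 : 'rV[K]_s) (pt : 'I_#|{: exps}| -> 'rV[K]_N)
    (I : Type) (Fs : I -> 'rV[K]_N -> 'rV[K]_s -> K) :
    injective pt -> (forall i, frob_rel l0 (pt i)) ->
    (forall j, reducible (Fs j)) ->
    (forall i, exists j, Fs j (pt i) l0 != 0) ->
  exists f, [/\ polyfun f, f l0 != 0 &
    forall l x, frob_rel l x -> (forall j, Fs j x l = 0) -> f l = 0].
Proof.
move=> pt_inj pt_rel redF F_sep.
have [j jP] := choice F_sep.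
have lag_ex i : exists f : 'rV[K]_N -> K,
    polyfun f /\ forall k, f (pt k) = (i == k)%:R.
  by have [f pf fE] := lagrange_polyfun pt_inj i; exists f.
have [lag lagP] := choice lag_ex.
pose F x l := \sum_i (Fs (j i) (pt i) l0)^-1 * (lag i x * Fs (j i) x l).
have red_F : reducible F.
  apply: reducible_sum => i; apply: reducible_scale; first exact: polyfun_cst.
  by apply: reducibleM => //; apply: reducible_polyfun; have [] := lagP i.
have F1 i : F (pt i) l0 = 1.
  rewrite /F (bigD1 i) //= big1 => [|k /negPf ki].
    by have [_ ->] := lagP i; rewrite eqxx addr0 mul1r mulVf.
  by have [_ ->] := lagP k; rewrite ki mul0r mulr0.
have [r rP] :=
  choice (fun a : exps => reducibleM red_F (reducible_mono (fun i => a i))).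
pose ev : 'I_#|{: exps}| -> exps := enum_val.
pose M l : 'M_#|{: exps}| := \matrix_(a, b) r (ev a) (ev b) l.
pose w x : 'cV_#|{: exps}| := \col_b mono x (fun i => ev b i).
have Mw l x : frob_rel l x -> M l *m w x = F x l *: w x.
  move=> lx; apply/colP=> a; rewrite !mxE.
  have [_ ->//] := rP (ev a).
  rewrite (reindex _ (onW_bij _ (@enum_val_bij exps))) /=.
  by apply: eq_bigr => b _; rewrite !mxE.
exists (fun l => \det (M l)); split=> [||l x lx Fx0].
- by apply: polyfun_det => a b; apply: polyfun_eq (proj1 (rP _) (ev b)) => x;
    rewrite mxE.
- pose E : 'M_#|{: exps}| := \matrix_(i, b) w (pt i) b 0.
  have EM : E *m (M l0)^T = E.
    apply/matrixP=> i a; have /colP /(_ a) := Mw _ _ (pt_rel i).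
    rewrite F1 scale1r => eqa; rewrite [RHS]mxE -eqa !mxE;
      apply: eq_bigr => b _.
    by rewrite !mxE mulrC.
  have EU : E \in unitmx.
    have [t tP] := choice (fun i => reducible_polyfun (proj1 (lagP i))).
    apply: (proj1 (@mulmx1_unit _ _ E (\matrix_(b, i) t i (ev b) l0) _)).
    apply/matrixP=> k i; rewrite !mxE eq_sym -(proj2 (lagP i) k).
    rewrite (proj2 (tP i) _ _ (pt_rel k)).
    rewrite [RHS](reindex _ (onW_bij _ (@enum_val_bij exps))) /=.
    by apply: eq_bigr => b _; rewrite !mxE mulrC.
  have M1 : (M l0)^T = 1%:M by rewrite -[LHS](mulKmx EU) EM mulVmx.
  by rewrite -det_tr M1 det1 oner_neq0.
- have Fx : F x l = 0 by rewrite /F big1 // => i _; rewrite Fx0 !mulr0.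
  apply/eqP/negPn/negP=> det0.
  have MU : M l \in unitmx by rewrite unitmxE unitfE.
  have := Mw _ _ lx; rewrite Fx scale0r => /(congr1 (mulmx (invmx (M l)))).
  rewrite mulKmx // mulmx0.
  (* The coordinate of the monomial 1 in the kernel vector is 1. *)
  pose a0 : exps := [ffun=> Ordinal (ltnW q_gt1)].
  move=> /colP /(_ (enum_rank a0)) /eqP; rewrite !mxE /ev enum_rankK /mono big1.
    by rewrite oner_eq0.
  by move=> i _; rewrite ffunE expr0.
Qed.

End FrobeniusCover.

(** * Noetherianity of the Zariski topology *)

Section Noetherian.
Local Open Scope classical_set_scope.

(** Repeatedly move to an index at which g is minimal among all later
    indices. *)
Lemma nondecreasing_subseq (g : nat -> nat) :
  exists2 t : nat -> nat, {homo t : i j / (i < j)%N} &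
    {homo (g \o t) : i j / (i <= j)%N}.
Proof.
have nextP i : exists j, (i <= j)%N /\ forall k, (i <= k)%N -> (g j <= g k)%N.
  have exP : exists v, `[< exists2 j, (i <= j)%N & g j = v >].
    by exists (g i); apply/asboolP; exists i.
  have [_ /asboolP[j ij <-] jmin] := ex_minnP exP.
  by exists j; split=> // k ik; apply: jmin; apply/asboolP; exists k.
have [next nextE] := choice nextP.
pose t := fix t k := next (if k is k'.+1 then (t k').+1 else 0%N).
exists t.
  apply: homo_ltn => [? ? ?|k]; first exact: ltn_trans.
  by have [] := nextE (t k).+1.
apply: homo_leq => [//|? ? ?|k /=]; first exact: leq_trans.
case: k => [|k] /=; first by have [_] := nextE 0%N; apply.
have [le1 min1] := nextE (t k).+1; apply: min1.
have [le2 _] := nextE (next (t k).+1).+1.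
by apply: leq_trans le2; rewrite (leq_trans le1).
Qed.

(** Extract a subsequence that is nondecreasing in every coordinate, one
    coordinate at a time. *)
Lemma dickson n (m : nat -> multinom n) :
  exists i j, (i < j)%N /\ forall k, (m i k <= m j k)%N.
Proof.
suff sub (s : seq 'I_n) : exists2 t : nat -> nat, {homo t : i j / (i < j)%N} &
    forall k, k \in s -> {homo (fun i => m (t i) k) : i j / (i <= j)%N}.
  have [t t_incr t_homo] := sub (enum 'I_n); exists (t 0%N), (t 1%N).
  by split=> [|k]; [exact: t_incr|apply: t_homo; rewrite ?mem_enum].
elim: s => [|k s [t t_incr t_homo]]; first by exists id.
have [u u_incr u_homo] := nondecreasing_subseq (fun i => m (t i) k).
exists (t \o u) => [i j /u_incr/t_incr //|k' ].
rewrite inE => /orP[/eqP->|/t_homo tk'] i j ij; first exact: u_homo.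
by apply: tk'; move: ij; rewrite leq_eqVlt => /orP[/eqP->|/u_incr/ltnW].
Qed.

Variables (K : closedFieldType) (N : nat).
Local Notation AN := (affine_space K N).

Let vanish (Z : set AN) (p : mpoly N K) := forall x, Z x ->
  meval ((x : 'rV_N) 0) p = 0.

Lemma minimal_mlead (P : mpoly N K -> Prop) : (exists p, P p) ->
  exists p, P p /\ forall r, P r -> ~~ (mlead r < mlead p)%O.
Proof.
move=> [p Pp]; apply/not_existsP => no_min.
elim/(well_founded_induction (@ltom_wf N)): {p}(mlead p) {-2}p (erefl (mlead p))
  Pp => m IH p pm Pp.
have /not_andP[//|/existsNP[r /not_implyP[Pr /negP/negPn rp]]] := no_min p.
by apply: (IH (mlead r) _ r) => //; rewrite -pm.
Qed.

(** The argument of Gordan for the basis theorem, applied directly to vanishing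
    ideals: choose p_i vanishing on Z_(i+1) but not on Z_i with the smallest
    possible leading monomial.  If the one of p_i divides the one of p_j with
    i < j, then cancelling the leading term of p_j by a multiple of p_i, which
    vanishes on Z_j, contradicts the choice of p_j. *)
Lemma closed_descending (Z : nat -> set AN) :
  (forall i, closed (Z i)) -> (forall i, Z i.+1 `<=` Z i) ->
  exists i, Z i `<=` Z i.+1.
Proof.
move=> Zc Zdec; apply/not_existsP => strict.
have Zle i j : (i <= j)%N -> Z j `<=` Z i.
  elim: j => [|j IH]; first by rewrite leqn0 => /eqP->.
  rewrite leq_eqVlt => /orP[/eqP->//|ij]; exact: subset_trans (IH ij).
have sep i : exists p, (vanish (Z i.+1) p /\ ~ vanish (Z i) p) /\
    forall r, vanish (Z i.+1) r /\ ~ vanish (Z i) r -> ~~ (mlead r < mlead p)%O.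
  apply: minimal_mlead; have /existsNP[x /not_implyP[Zx Zx']] := strict i.
  have [S ZS] := (zariski_closedE _).1 (Zc i.+1).
  move: Zx'; rewrite {1}ZS => /existsNP[p /not_implyP[Sp px]].
  exists p; split=> [y|/(_ _ Zx)//]; rewrite ZS; exact.
have [p' p'P] := choice sep.
have [i [j [ij leij]]] := dickson (fun i => mlead (p' i)).
have [[pi0 pi_n0] _] := p'P i; have [[pj0 pj_n0] pj_min] := p'P j.
have nz k : p' k != 0.
  by apply/eqP=> pk0; have [[_]] := p'P k; case; rewrite pk0 => x _;
    rewrite meval0.
pose d := mnm_sub (mlead (p' j)) (mlead (p' i)).
have dE : mnm_add d (mlead (p' i)) = mlead (p' j).
  by apply/mnmP=> k; rewrite mnmDE mnmBE subnK.
pose u := mleadc (p' j) / mleadc (p' i) *: (mpolyX K d * p' i).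
have u_lead : mlead u = mlead (p' j).
  have Xd0 : mpolyX K d != 0 by rewrite -mleadc_eq0 mleadXm mcoeffX eqxx
    oner_eq0.
  rewrite mleadZ ?mulf_neq0 ?invr_eq0 ?mleadc_eq0 //.
  by rewrite mleadM // mleadXm dE.
have u_coef : mcoeff (mlead (p' j)) u = mleadc (p' j).
  have coef_Xp : mcoeff (mlead (p' j)) (mpolyX K d * p' i) = mleadc (p' i).
    by rewrite -dE mulrC mcoeffMX.
  by rewrite mcoeffZ coef_Xp divfK // mleadc_eq0.
have u_van : vanish (Z j) u.
  move=> x Zx; rewrite mevalZ mevalM (pi0 x) ?mulr0 //; exact: Zle Zx.
have /negP[] : ~~ (mlead (p' j - u) < mlead (p' j))%O.
  apply: pj_min; split=> [x Zx|van].
    by rewrite mevalB pj0 // u_van ?subr0 //; apply: Zdec.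
  by apply: pj_n0 => x Zx; have := van x Zx; rewrite mevalB (u_van x) // subr0.
have r_nz : p' j - u != 0.
  apply/eqP=> /eqP; rewrite subr_eq0 => /eqP pju; apply: pj_n0; rewrite pju.
  exact: u_van.
rewrite lt_neqAle; apply/andP; split; last first.
  by have := mleadB_le (p' j) u; rewrite u_lead joinxx.
apply: contraNneq r_nz => eq_lead; rewrite -mleadc_eq0 eq_lead mcoeffB u_coef.
by rewrite subrr.
Qed.

End Noetherian.

Section FinitelyManyComponents.
Local Open Scope classical_set_scope.
Variables (K : closedFieldType) (N : nat).
Local Notation AN := (affine_space K N).

(** Noetherian induction on W: if the trace of W on A is disconnected, it is
    covered by the traces of two smaller closed sets. *)
Lemma connected_cover (A : set AN) (W : set AN) : closed W ->
  exists s : seq (set AN), (forall C, C \in s -> C `<=` A /\ connected C) /\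
    forall x, A x -> W x -> exists2 C, C \in s & C x.
Proof.
pose good (V : set AN) := exists s : seq (set AN),
  (forall C, C \in s -> C `<=` A /\ connected C) /\
  forall x, A x -> V x -> exists2 C, C \in s & C x.
have step V : closed V -> ~ good V ->
    exists V', [/\ closed V', ~ good V', V' `<=` V & ~ V `<=` V'].
  move=> Vc Vbad.
  have : ~ connected (A `&` V).
    move=> AVconn; apply: Vbad; exists [:: A `&` V]; split=> [C|x Ax Vx].
      by rewrite mem_seq1 => /eqP->; split=> // x [].
    by exists (A `&` V); rewrite ?mem_seq1.
  move=> /existsNP[B /not_implyP[[x0 Bx0] /not_implyP[[C Co BC]]]].
  move=> /not_implyP[[D Dc BD] BneAV].
  have V1c : closed (V `&` D) by apply: closedI.
  have V2c : closed (V `&` ~` C) by apply: closedI => //; apply: open_closedC.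
  have [good1|bad1] := pselect (good (V `&` D)); last first.
    exists (V `&` D); split=> // VD; apply: BneAV.
    by rewrite BD; apply/seteqP; split=> [x []//|x AVx]; split=> //;
      have [_ /VD[]] := AVx.
  have [good2|bad2] := pselect (good (V `&` ~` C)); last first.
    exists (V `&` ~` C); split=> // VC.
    by move: Bx0; rewrite BC => -[[_ /VC[]]].
  case: Vbad; have [s1 [s1P s1V]] := good1; have [s2 [s2P s2V]] := good2.
  exists (s1 ++ s2); split=> [E|x Ax Vx].
    by rewrite mem_cat => /orP[/s1P|/s2P].
  have [Dx|Dx] := pselect (D x).
    by have [E Es Ex] := s1V x Ax (conj Vx Dx); exists E; rewrite // mem_cat Es.
  have [|E Es Ex] := s2V x Ax; last by exists E; rewrite // mem_cat Es orbT.
  split=> // Cx; apply: Dx; have : B x by rewrite BC.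
  by rewrite BD => -[].
move=> Wc; apply: contrapT => Wbad.
pose T := {V : set AN | closed V /\ ~ good V}.
have ex_smaller (V : T) :
    exists V' : T, sval V' `<=` sval V /\ ~ sval V `<=` sval V'.
  case: V => V [Vc Vbad]; have [V' [V'c V'bad sub nsub]] := step V Vc Vbad.
  by exists (exist _ V' (conj V'c V'bad)).
have [f fP] := choice ex_smaller.
pose Z i : T := iter i f (exist _ W (conj Wc Wbad)).
have [i|i|i] := @closed_descending K N (fun i => sval (Z i)).
- by have [] := svalP (Z i).
- by have [] := fP (Z i).
- by have [_] := fP (Z i).
Qed.

(** Two points in the same member of a finite connected cover have the same
    component. *)
Lemma finite_components (A : set AN) :
  finite_set [set connected_component A g | g in A].
Proof.
have [s [sP s_cover]] := connected_cover A closedT.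
apply: (@sub_finite_set _ _
  [set \bigcup_(y in C) connected_component A y | C in [set` s]]); last first.
  exact/finite_image/finite_seq.
move=> _ [g Ag <-]; have [C Cs Cg] := s_cover g Ag I.
have [CA Cconn] := sP C Cs; exists C => //.
apply/seteqP; split=> [x [y Cy]|x]; last by exists g.
suff -> : connected_component A g = connected_component A y by [].
by apply: same_connected_component; apply: (connected_component_max Cg).
Qed.

End FinitelyManyComponents.

(** * Forms of a structure tensor and the automorphisms they define *)

Lemma invmxM (R : comUnitRingType) n (A B : 'M[R]_n) :
  A \in unitmx -> B \in unitmx -> invmx (A *m B) = invmx B *m invmx A.
Proof.
move=> AU BU; have ABU : A *m B \in unitmx by rewrite unitmx_mul AU.
by rewrite -[RHS](mulKmx ABU) -mulmxA mulKVmx // mulmxV // mulmx1.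
Qed.

Section TensorIso.
Variable n : nat.

(** The Kronecker square of g: its action on mxvec (x^T *m y), the coordinates of
    the tensor of x and y. *)
Definition tens (R : comNzRingType) (g : 'M[R]_n) : 'M[R]_(n * n) :=
  lin_mx (mulmxr g \o mulmx g^T).

Lemma tensE (R : comNzRingType) (g : 'M[R]_n) i j k l :
  tens g (mxvec_index i j) (mxvec_index k l) = g i k * g j l.
Proof.
rewrite /tens !mxE /= vec_mx_delta mxvecE -(mul_delta_mx (0 : 'I_1)).
by rewrite mulmxA -colE -mulmxA -rowE !mxE big_ord1 !mxE.
Qed.

Lemma mxvec_tens (R : comNzRingType) (g : 'M[R]_n) X :
  mxvec X *m tens g = mxvec (g^T *m X *m g).
Proof. by rewrite mul_vec_lin. Qed.

Lemma tensM (R : comNzRingType) (g h : 'M[R]_n) : tens (g *m h) =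
  tens g *m tens h.
Proof.
apply/row_matrixP=> i; rewrite !rowE mulmxA -[delta_mx 0 i]vec_mxK !mxvec_tens.
by rewrite trmx_mul !mulmxA.
Qed.

Lemma tens1 (R : comNzRingType) : tens (1%:M : 'M[R]_n) = 1%:M.
Proof.
apply/row_matrixP=> i; rewrite !rowE mulmx1 -[delta_mx 0 i]vec_mxK mxvec_tens.
by rewrite trmx1 mul1mx mulmx1.
Qed.

Lemma map_tens (R S : comNzRingType) (f : {rmorphism R -> S}) (g : 'M[R]_n) :
  map_mx f (tens g) = tens (map_mx f g).
Proof.
apply/matrixP=> i j; case/mxvec_indexP: i => i1 i2;
  case/mxvec_indexP: j => j1 j2.
by rewrite mxE !tensE rmorphM !mxE.
Qed.

(** A matrix C of size (n * n) x n encodes the bilinear product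
    (x, y) |-> mxvec (x^T *m y) *m C on row vectors, and [mx_iso C D g] says that
    x |-> x *m g is an isomorphism from the product C to the product D; see
    [mx_mulP].  A unit is automatically preserved, by [bij_mul_aone]. *)
Definition mx_iso (R : comUnitRingType) (C D : 'M[R]_(n * n, n)) (g : 'M_n) :=
  (g \in unitmx) && (C *m g == tens g *m D).

Lemma mx_iso_comp (R : comUnitRingType) (C D E : 'M[R]_(n * n, n)) g h :
  mx_iso C D g -> mx_iso D E h -> mx_iso C E (g *m h).
Proof.
move=> /andP[gU /eqP Cg] /andP[hU /eqP Dh]; rewrite /mx_iso unitmx_mul gU hU /=.
by rewrite mulmxA Cg -mulmxA Dh mulmxA tensM.
Qed.

Lemma mx_iso_inv (R : comUnitRingType) (C D : 'M[R]_(n * n, n)) g :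
  mx_iso C D g -> mx_iso D C (invmx g).
Proof.
move=> /andP[gU /eqP Cg]; rewrite /mx_iso unitmx_inv gU /=; apply/eqP.
rewrite -[D in LHS]mul1mx -tens1 -(mulVmx gU) tensM -[_ *m D]mulmxA -Cg.
by rewrite !mulmxA mulmxK.
Qed.

Lemma map_mx_iso (R S : comUnitRingType) (f : {rmorphism R -> S})
    (C D : 'M[R]_(n * n, n)) g :
  mx_iso C D g -> mx_iso (map_mx f C) (map_mx f D) (map_mx f g).
Proof.
move=> /andP[gU /eqP Cg]; rewrite /mx_iso -map_tens -!map_mxM Cg eqxx andbT.
by rewrite unitmxE det_map_mx rmorph_unit // -unitmxE.
Qed.

Lemma map_field_mx_iso (R S : fieldType) (f : {rmorphism R -> S})
    (C D : 'M[R]_(n * n, n)) g :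
  mx_iso (map_mx f C) (map_mx f D) (map_mx f g) = mx_iso C D g.
Proof. by rewrite /mx_iso -map_tens -!map_mxM map_unitmx
  (inj_eq (@map_mx_inj _ _ f _ _)). Qed.

Lemma mx_iso_transport (R : comUnitRingType) (C : 'M[R]_(n * n, n)) g :
  g \in unitmx -> mx_iso (tens g *m C *m invmx g) C g.
Proof. by move=> gU; rewrite /mx_iso gU mulmxKV //=. Qed.

End TensorIso.

Section Descent.
Variables (F : finFieldType) (K : closedFieldType) (iota : {rmorphism F -> K}).
Variable phi : {rmorphism K -> K}.
Hypothesis phiE : forall x, phi x = x ^+ #|F|.

Let q_gt1 : (1 < #|F|)%N := finNzRing_gt1 F.

Lemma frob_iota a : phi (iota a) = iota a.
Proof. by rewrite phiE -rmorphXn /= expf_card. Qed.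

(** The elements of F are the q roots of X ^ q - X. *)
Lemma frob_fixed x : phi x = x -> exists a, x = iota a.
Proof.
move=> phix;
  have := congr1 (fun p => (map_poly iota p).[x]) (finField_genPoly F).
rewrite /= rmorphB rmorph_prod /= map_polyXn map_polyX !hornerE -phiE phix
  subrr.
rewrite horner_prod => /esym/eqP; rewrite prodf_seq_eq0 => /hasP[a _ /=].
by rewrite rmorphB /= map_polyX map_polyC !hornerE subr_eq0 => /eqP; exists a.
Qed.

Lemma frob_iota_mx m k (M : 'M[F]_(m, k)) :
  map_mx phi (map_mx iota M) = map_mx iota M.
Proof. by apply/matrixP=> i j; rewrite !mxE frob_iota. Qed.

Lemma frob_fixed_mx m k (M : 'M[K]_(m, k)) :
  map_mx phi M = M -> exists M0, M = map_mx iota M0.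
Proof.
move=> phiM; have fixM ij : exists a, M ij.1 ij.2 = iota a.
  by apply: frob_fixed; move/matrixP: phiM => /(_ ij.1 ij.2); rewrite mxE.
have [f fE] := choice fixM; exists (\matrix_(i, j) f (i, j)).
by apply/matrixP=> i j; rewrite !mxE -fE.
Qed.

Variable n : nat.
Variable C : 'M[F]_(n * n, n).
Implicit Types (D : 'M[F]_(n * n, n)) (a : 'M[K]_n).
Local Notation "D ^i" := (map_mx iota D) (at level 2, format "D ^i").

(** The isomorphisms from D to C over K are a torsor under the automorphism group
    of C; a is the value at the Frobenius of a cocycle describing it. *)
Definition cocycle_of D a :=
  exists2 x, mx_iso D^i C^i x & map_mx phi x = x *m a.

(** The form is C transported along a solution x of phi(x) = x a; it is
    F-rational because a preserves C. *)
Lemma cocycle_ex a : mx_iso C^i C^i a -> exists D, cocycle_of D a.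
Proof.
move=> /andP[aU /eqP Ca]; have [x xU xa] := lang_GL q_gt1 phiE aU.
have [|D DE] := @frob_fixed_mx _ _ (tens x *m C^i *m invmx x).
  rewrite !map_mxM map_invmx map_tens frob_iota_mx xa tensM invmxM //.
  by rewrite -[tens x *m tens a *m _]mulmxA -Ca !mulmxA mulmxK.
by exists D, x; rewrite // -DE; apply: mx_iso_transport.
Qed.

Lemma cocycle_iso D D' g a : mx_iso D D' g -> cocycle_of D' a -> cocycle_of D a.
Proof.
move=> /(map_mx_iso iota) iso_g [x iso_x xa]; exists (g^i *m x).
  exact: mx_iso_comp iso_g iso_x.
by rewrite map_mxM frob_iota_mx xa mulmxA.
Qed.

(** If phi(x) = x a and phi(y) = y a, then x y^-1 is fixed by phi. *)
Lemma cocycle_inj D D' a : cocycle_of D a -> cocycle_of D' a ->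
  exists g, mx_iso D D' g.
Proof.
move=> [x iso_x xa] [y iso_y ya].
have iso_xy := mx_iso_comp iso_x (mx_iso_inv iso_y).
have aU : a \in unitmx.
  have /andP[xU _] := iso_x;
    have : map_mx phi x \in unitmx by rewrite map_unitmx.
  by rewrite xa unitmx_mul => /andP[].
have [|g gE] := @frob_fixed_mx _ _ (x *m invmx y).
  have /andP[yU _] := iso_y.
  by rewrite map_mxM map_invmx xa ya invmxM // !mulmxA mulmxK.
by exists g; rewrite -(map_field_mx_iso iota) -gE.
Qed.

(** Apply [separate_from_image] to the set of the isomorphisms x from D to C.
    The solutions of phi(x) = x a0 are the q ^ (n * n) matrices h x0 with h over
    F, and such an h x0 is an isomorphism from D only if h is one from D to D0.
    Invertibility of x is not a closed condition, but among the solutions of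
    phi(x) = x a it amounts to det(x) ^ (q - 1) = det(a), because
    det(x) ^ q = det(x) det(a). *)
Lemma cocycle_separation D0 D a0 : cocycle_of D0 a0 ->
    ~ (exists g, mx_iso D D0 g) ->
  exists f, [/\ polyfun f, f (mxvec a0) != 0 &
    forall a, cocycle_of D a -> f (mxvec a) = 0].
Proof.
move=> [x0 iso_x0 x0a] not_iso; have /andP[x0U /eqP x0E] := iso_x0.
have a0U : a0 \in unitmx.
  have : map_mx phi x0 \in unitmx by rewrite map_unitmx.
  by rewrite x0a unitmx_mul => /andP[].
pose N := (n * n)%N.
(* With x and l flattened to vectors, phi(x) = x l is the system frob_rel for
   these coefficients; see relE. *)
pose c (i k : 'I_N) (l : 'rV[K]_N) := lin_mulmxr (vec_mx l : 'M_n) k i.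
have pc i k : polyfun (c i k).
  rewrite /c; case/mxvec_indexP: i => i1 i2.
  apply: (@polyfun_eq _ _ (fun l =>
    \sum_j (vec_mx (delta_mx 0 k) : 'M[K]_n) i1 j * l 0 (mxvec_index j i2))).
    by move=> l; rewrite !mxE mxvecE mxE; apply: eq_bigr => j _; rewrite !mxE.
  apply: polyfun_sum => j _; apply: polyfunM; first exact: polyfun_cst.
  exact: polyfun_coord.
have relE l x : frob_rel #|F| c l x <-> map_mx phi (vec_mx x) =
  vec_mx x *m vec_mx l :> 'M_n.
  have sumE i : \sum_k c i k l * x 0 k = mxvec (vec_mx x *m vec_mx l) 0 i.
    transitivity ((x *m lin_mulmxr (vec_mx l : 'M_n)) 0 i).
      by rewrite mxE; apply: eq_bigr => k _; rewrite mulrC.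
    by rewrite mul_rV_lin.
  split=> [rel|eqx i].
    apply: (can_inj mxvecK); apply/rowP=> i; rewrite -sumE -rel.
    by rewrite -map_mxvec vec_mxK mxE phiE.
  by rewrite sumE -eqx -map_mxvec vec_mxK mxE phiE.
have card_pts : #|{: {ffun 'I_N -> 'I_(#|F|)}}| = #|{: 'M[F]_n}|.
  by rewrite card_ffun !card_ord card_mx.
pose h i : 'M[F]_n := enum_val (cast_ord card_pts i).
pose pt i : 'rV[K]_N := mxvec ((h i)^i *m x0).
pose Fs (j : option ('I_N * 'I_n)) (x : 'rV[K]_N) (l : 'rV[K]_N) : K :=
  if j is Some (u, k) then
    (D^i *m vec_mx x) u k - (tens (vec_mx x) *m C^i) u k
  else (\det (vec_mx x : 'M_n)) ^+ #|F|.-1 - \det (vec_mx l : 'M_n).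
have [||j|i|f [pf f0 f_van]] := @separate_from_image K #|F| N N q_gt1 c pc
  (mxvec a0) pt _ Fs.
- move=> i j /(can_inj mxvecK) /(can_inj (mulmxK x0U)) /map_mx_inj
    /enum_val_inj.
  exact: cast_ord_inj.
- move=> i; apply/relE; rewrite !mxvecK map_mxM frob_iota_mx x0a.
  by rewrite mulmxA.
- have entry (u v : 'I_n) : polyfun (fun x : 'rV[K]_N => (vec_mx x : 'M_n) u v).
    by apply: polyfun_eq (polyfun_coord _ (mxvec_index u v)) => x; rewrite mxE.
  have det_poly : polyfun (fun x : 'rV[K]_N => \det (vec_mx x : 'M_n)).
    exact: polyfun_det.
  case: j => [[u k]|]; last first.
    apply: reducibleB; last by apply: reducible_cst.
    by apply: (reducible_polyfun q_gt1 pc (f := fun x => _ ^+ _));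
      apply: polyfunX.
  apply: (reducible_polyfun q_gt1 pc (f := fun x => _ - _)).
  apply: polyfunB.
    apply: (@polyfun_eq _ _ (fun x => \sum_t D^i u t * (vec_mx x : 'M_n) t k)).
      by move=> x; rewrite mxE.
    by apply: polyfun_sum => t _; apply: polyfunM => //; apply: polyfun_cst.
  apply:
    (@polyfun_eq _ _ (fun x => \sum_t tens (vec_mx x : 'M_n) u t * C^i t k)).
    by move=> x; rewrite mxE.
  apply: polyfun_sum => t _; apply: polyfunM; last exact: polyfun_cst.
  case/mxvec_indexP: u => u1 u2; case/mxvec_indexP: t => t1 t2.
  by apply: polyfun_eq (polyfunM (entry u1 t1) (entry u2 t2)) => x;
    rewrite tensE.
- have [hU|hU] := boolP (h i \in unitmx); last first.
    exists None; rewrite /Fs /pt !mxvecK det_mulmx det_map_mx.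
    move: hU; rewrite unitmxE unitfE negbK => /eqP->.
    have q1_gt0 : (#|F|.-1 == 0)%N = false by move: q_gt1; case: #|F| => [|[]].
    by rewrite rmorph0 mul0r expr0n q1_gt0 add0r oppr_eq0 -unitfE -unitmxE.
  have /eqP/matrixP h_not : D *m h i != tens (h i) *m D0.
    by apply/negP=> /eqP hE; apply: not_iso; exists (h i);
      rewrite /mx_iso hU hE eqxx.
  apply: contrapT => /forallNP all0; apply: h_not => u k.
  have : D^i *m ((h i)^i *m x0) = tens ((h i)^i *m x0) *m C^i.
    apply/matrixP=> u' k'; apply/eqP; rewrite -subr_eq0; apply/negPn/negP.
    by move: (all0 (Some (u', k'))); rewrite /Fs /pt mxvecK.
  rewrite tensM -mulmxA -x0E !mulmxA => /(can_inj (mulmxK x0U)).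
  by rewrite -map_tens -!map_mxM => /map_mx_inj/matrixP.
- exists f; split=> // a [x /andP[xU /eqP xE] xa].
  apply: (f_van _ (mxvec x)); first by apply/relE; rewrite !mxvecK.
  case=> [[u k]|] /=; rewrite !mxvecK; first by rewrite xE subrr.
  have detx0 : \det x != 0 by rewrite -unitfE -unitmxE.
  apply/eqP;
    rewrite subr_eq0 -(inj_eq (mulfI detx0)) -exprS prednK ?(ltnW q_gt1) //.
  by rewrite -phiE -det_map_mx xa det_mulmx.
Qed.

End Descent.

(** * Connected components and descent *)

Section PeriodicPoint.

(** The exact period of x divides m and is at most the number of elements of U,
    so it divides the factorial of this number as well. *)
Lemma periodic_fixed_point (X : choiceType) (U : {fset X}) (f : X -> X) x m :
    (forall y, y \in U -> f y \in U) -> x \in U ->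
    (0 < m)%N -> iter m f x = x -> coprime m (#|` U|)`! ->
  f x = x.
Proof.
move=> fU xU m_gt0 fmx co.
have ex_per : exists k, (0 < k)%N && (iter k f x == x) by exists m;
  rewrite m_gt0 fmx eqxx.
have [l /andP[l_gt0 /eqP flx] l_min] := ex_minnP ex_per.
have iter_mul k : iter (k * l) f x = x.
  by elim: k => // k IH; rewrite mulSn iterD IH.
have l_dvd : (l %| m)%N.
  rewrite /dvdn; apply/negPn/negP; rewrite -lt0n => r_gt0.
  have per : iter (m %% l) f x = x.
    by rewrite -[in RHS]fmx [in RHS](divn_eq m l) addnC iterD iter_mul.
  by have := l_min (m %% l)%N;
    rewrite r_gt0 per eqxx leqNgt ltn_mod l_gt0 => /(_ isT).
have uniq_orb : uniq (traject f x l).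
  apply/(uniqP x) => i j; rewrite !inE size_traject => il jl.
  rewrite !nth_traject //; wlog ij : i j il jl / (i <= j)%N.
    by move=> W; have [/W|/ltnW/W Wji eqij] := leqP i j; [apply|apply/esym/Wji].
  move=> eqij; apply/eqP; rewrite eqn_leq ij /= leqNgt; apply/negP=> lt_ij.
  have : iter (l - (j - i)) f x = x.
    rewrite -{2}flx -{2}(subnK (ltnW jl)) iterD -eqij -iterD; congr iter.
    by rewrite subnBA // addnBAC // ltnW.
  move=> per; have := l_min (l - (j - i))%N; rewrite per eqxx andbT subn_gt0.
  rewrite (leq_ltn_trans (leq_subr _ _) jl) => /(_ isT).
  by rewrite leqNgt ltn_subrL l_gt0 subn_gt0 lt_ij.
have l_le : (l <= #|` U|)%N.
  rewrite -(size_traject f x l);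
    apply: (@uniq_leq_size _ _ (enum_fset U)) => // y.
  move=> /trajectP[i _ ->]; elim: i => //= i IH; exact: fU.
have : (l %| gcdn m (#|` U|)`!)%N by rewrite dvdn_gcd l_dvd dvdn_fact // l_gt0.
by rewrite (eqP co) dvdn1 => /eqP l1; rewrite l1 in flx.
Qed.

End PeriodicPoint.

Section ConnectedComponents.
Local Open Scope classical_set_scope.

Lemma polyfun_comp (K : fieldType) N M (p : mpoly M K) (T : 'rV[K]_N ->
  'rV[K]_M) :
  (forall i, polyfun (fun v => T v 0 i)) -> polyfun (fun v => meval (T v 0) p).
Proof.
move=> pT; apply: (@polyfun_eq _ _ (fun v =>
  \sum_(m <- msupp p) mcoeff m p * \prod_i T v 0 i ^+ m i)).
  by move=> v; rewrite mevalE.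
apply: polyfun_sum => m _; apply: polyfunM; first exact: polyfun_cst.
by apply: polyfun_prod => i _; apply: polyfunX.
Qed.

Lemma polynomial_map_continuous (K : closedFieldType) N M
    (T : affine_space K N -> affine_space K M) :
  (forall i, polyfun (fun v : 'rV[K]_N => (T v : 'rV[K]_M) 0 i)) ->
    continuous T.
Proof.
move=> pT; apply/continuous_closedP => Z /zariski_closedE[S ->].
apply/zariski_closedE; exists [set p | exists2 r, S r &
  forall v : 'rV[K]_N, meval (v 0) p = meval ((T v : 'rV[K]_M) 0) r].
apply/seteqP; split=> v Tv.
  by move=> p [r Sr ->]; apply: Tv.
move=> r Sr; have [p pE] := polyfun_comp r pT.
have <- : meval ((v : 'rV_N) 0) p = meval ((T v : 'rV[K]_M) 0) r by rewrite -pE.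
by apply: Tv; exists r.
Qed.

Variables (F : finFieldType) (K : closedFieldType) (iota : {rmorphism F -> K}).
Variable phi : {rmorphism K -> K}.
Hypothesis phiE : forall x, phi x = x ^+ #|F|.
Variables (n : nat) (C : 'M[F]_(n * n, n)).
Local Notation "D ^i" := (map_mx iota D) (at level 2, format "D ^i").
Local Notation AN := (affine_space K (n * n)).

Definition aut_set : set AN := [set mxvec a | a in [set a | mx_iso C^i C^i a]].

(** The elements of S that come from the form C are cut out in S by a closed set,
    as each other element a0 is separated from them by [cocycle_separation].
    They are also cut out by an open set: the product of the separating
    functions over the finitely many forms D not isomorphic to C vanishes on all
    the others. *)
Lemma connected_cocycle (S : set AN) a b :
    S `<=` aut_set -> connected S -> S (mxvec a) -> S (mxvec b) ->
  cocycle_of iota phi C C a -> cocycle_of iota phi C C b.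
Proof.
move=> S_aut S_conn Sa Sb inner_a.
pose inner (v : AN) := cocycle_of iota phi C C (vec_mx (v : 'rV[K]__)).
pose van (P : AN -> Prop) :=
  [set p | forall w : AN, aut_set w -> P w -> meval ((w : 'rV[K]__) 0) p = 0].
suff SE : S `&` [set v | inner v] = S.
  by move: Sb; rewrite -SE => -[_]; rewrite /inner /= mxvecK.
apply: S_conn.
- by exists (mxvec a); split=> //; rewrite /inner /= mxvecK.
- exists (~` zero_locus (van (fun w => ~ inner w))).
    by apply: closed_openC; apply/zariski_closedE; eexists.
  apply/seteqP; split=> v [Sv]; last first.
    move=> vP; split=> //; apply: contrapT => not_inner; apply: vP => p;
      apply=> //.
    exact: S_aut.
  move=> inner_v; split=> // v_van.
  (* For D isomorphic to C the constant 1 serves, so that the product can range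
     over all D. *)
  have sep D : exists f, [/\ polyfun f, f v != 0 & (~ exists g, mx_iso D C g) ->
      forall w, cocycle_of iota phi C D w -> f (mxvec w) = 0].
    have [iso|not_iso] := pselect (exists g, mx_iso D C g).
      exists (fun=> 1); split=> //; [exact: polyfun_cst|exact: oner_neq0].
    have [f [pf f0 f_van]] := cocycle_separation phiE inner_v not_iso.
    by exists f; split=> //; move: f0; rewrite vec_mxK.
  have [f fP] := choice sep.
  have [|p pE] := @polyfun_prod K (n * n) _ (enum {: 'M[F]_(n * n, n)}) predT f.
    by move=> D _; have [] := fP D.
  have : meval ((v : 'rV[K]__) 0) p = 0.
    apply: v_van => w [c c_aut <-]; rewrite /inner /= mxvecK -pE => not_inner_c.
    have [D cD] := cocycle_ex phiE c_aut.
    have not_iso : ~ exists g, mx_iso D C g.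
      by case=> g /mx_iso_inv iso_g; apply: not_inner_c;
        exact: cocycle_iso iso_g cD.
    rewrite (bigD1_seq D) ?enum_uniq ?mem_enum //=.
    by have [_ _ ->//] := fP D; rewrite mul0r.
  by apply/eqP; rewrite -pE prodf_seq_neq0; apply/allP => D _ /=;
    have [] := fP D.
- exists (zero_locus (van inner)); first by apply/zariski_closedE; eexists.
  apply/seteqP; split=> v [Sv].
    by move=> inner_v; split=> // p; apply=> //; exact: S_aut.
  move=> v_van; split=> //; apply: contrapT => not_inner.
  have [c c_aut cv] := S_aut v Sv.
  have [D cD] := cocycle_ex phiE c_aut.
  have not_iso : ~ exists g, mx_iso C D g.
    case=> g iso_g; apply: not_inner; rewrite /inner -cv /= mxvecK.
    exact: cocycle_iso iso_g cD.
  have [f [[p pf] f0 f_van]] := cocycle_separation phiE cD not_iso.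
  move: f0; rewrite cv pf v_van ?eqxx // => w _ /f_van.
  by rewrite vec_mxK pf.
Qed.

(** The self-map T(g) = a phi(g) of the automorphism group, with
    a = u^-1 phi(u), is g |-> u^-1 phi(u g), that is, phi read on the isomorphisms
    u g from D to C through the bijection g |-> u g.  This explains why
    T^m(1) = u^-1 phi^m(u). *)
Theorem descent (D : 'M[F]_(n * n, n)) (u : 'M[K]_n) m :
    mx_iso D^i C^i u -> (0 < m)%N -> iter m (map_mx phi) u = u ->
    coprime m
      (#|` fset_set [set connected_component aut_set g | g in aut_set]|)`! ->
  exists g, mx_iso D C g.
Proof.
move=> iso_u m_gt0 phi_u co.
have /andP[uU _] := iso_u.
pose a := invmx u *m map_mx phi u.
have ua : map_mx phi u = u *m a by rewrite mulKVmx.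
have a_aut : mx_iso C^i C^i a.
  apply: mx_iso_comp (mx_iso_inv iso_u) _.
  by have := map_mx_iso phi iso_u; rewrite !frob_iota_mx.
have aU : a \in unitmx by case/andP: a_aut.
pose T (v : AN) : AN := mxvec (a *m map_mx phi (vec_mx (v : 'rV[K]__))).
have T_aut v : aut_set v -> aut_set (T v).
  case=> g g_aut <-; exists (a *m map_mx phi g); last by rewrite /T mxvecK.
  by apply: mx_iso_comp a_aut _; have := map_mx_iso phi g_aut;
    rewrite !frob_iota_mx.
have T_cont : continuous T.
  apply: polynomial_map_continuous => i; case/mxvec_indexP: i => i j.
  apply:
    (@polyfun_eq _ _ (fun v => \sum_k a i k * v 0 (mxvec_index k j) ^+ #|F|)).
    by move=> v; rewrite mxvecE mxE; apply: eq_bigr => k _; rewrite !mxE phiE.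
  apply: polyfun_sum => k _; apply: polyfunM; first exact: polyfun_cst.
  exact/polyfunX/polyfun_coord.
pose comp := connected_component aut_set.
have T_comp v w : comp v w -> comp (T v) (T w).
  move=> vw.
  have v_aut : aut_set v.
    by apply: (connected_component_sub (connected_component_sym vw)).
  apply: (@connected_component_max _ _ (T @` comp v) (T v)).
  - by exists v => //; apply: connected_component_refl.
  - by move=> _ [z /connected_component_sub z_aut <-]; apply: T_aut.
  - apply: connected_continuous_connected; first exact: component_connected.
    exact: continuous_subspaceT.
  - by exists w.
(* The map induced by T on the set of components, defined without choosing a
   point in each of them. *)
pose tau (Y : set AN) : set AN := \bigcup_(y in Y) comp (T y).
have tauE v : aut_set v -> tau (comp v) = comp (T v).
  move=> v_aut; apply/seteqP; split=> [z [y vy]|z Tvz].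
    by rewrite /comp -(same_connected_component (T_comp _ _ vy)).
  by exists v => //; apply: connected_component_refl.
pose one : AN := mxvec (1%:M : 'M[K]_n).
have one_aut : aut_set one.
  by exists 1%:M => //=; rewrite /mx_iso unitmx1 tens1 mul1mx mulmx1 /=.
have iterT k : iter k T one = mxvec (invmx u *m iter k (map_mx phi) u).
  elim: k => [|k IH] /=; first by rewrite mulVmx.
  rewrite IH /T mxvecK map_mxM map_invmx ua invmxM // !mulmxA.
  by rewrite mulmxV // mul1mx.
have iter_aut k : aut_set (iter k T one) by elim: k => //= k; apply: T_aut.
have iter_tau k : iter k tau (comp one) = comp (iter k T one).
  by elim: k => //= k ->; rewrite tauE.
have fin := finite_components aut_set.
have : tau (comp one) = comp one.
  apply: (@periodic_fixed_point _ (fset_set (comp @` aut_set)) tau _ m) => //.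
  - move=> Y; rewrite !in_fset_set // !inE => -[v v_aut <-].
    by rewrite tauE //; exists (T v) => //; apply: T_aut.
  - by rewrite in_fset_set // inE; exists one.
  - by rewrite iter_tau iterT phi_u mulVmx.
rewrite tauE // => comp_eq.
have inner1 : cocycle_of iota phi C C 1%:M.
  exists 1%:M; last by rewrite map_mx1 mulmx1.
  by rewrite /mx_iso unitmx1 tens1 mul1mx mulmx1 /=.
have T1 : T one = mxvec a by rewrite /T /one mxvecK map_mx1 mulmx1.
have inner_a : cocycle_of iota phi C C a.
  apply: (@connected_cocycle (comp one) 1%:M) inner1.
  - exact: connected_component_sub.
  - exact: component_connected.
  - exact: connected_component_refl.
  - rewrite -comp_eq -T1; apply: connected_component_refl; exact: T_aut.
by apply: cocycle_inj inner_a => //; exists u.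
Qed.

End ConnectedComponents.

(** * Finite fields inside an algebraically closed field *)

Section Embedding.
Variables (F : finFieldType) (K : closedFieldType) (iota : {rmorphism F -> K}).

Lemma frobenius_ex :
  exists phi : {rmorphism K -> K}, forall x, phi x = x ^+ #|F|.
Proof.
have [p p_pr pcharF] := finPcharP F.
have pcharK : p \in [pchar K] by rewrite (fmorph_pchar iota).
have cardF : #|F| = (p ^ logn p #|F|)%N := card_pprimeChar pcharF.
pose f (x : K) := x ^+ #|F|.
have fB : zmod_morphism f.
  move=> x y; rewrite /f cardF; elim: (logn _ _) => // k IH.
  by rewrite expnSr !exprM IH -!(pFrobenius_autE pcharK) rmorphB.
have fM : monoid_morphism f by rewrite /f; split=> [|x y];
  rewrite ?expr1n ?exprMn.
pose phi : {rmorphism K -> K} :=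
  HB.pack f (GRing.isZmodMorphism.Build _ _ f fB)
    (GRing.isMonoidMorphism.Build _ _ f fM).
by exists phi.
Qed.

(** E is generated over F by one element z because it is separable.  Send z to a
    root t of its minimal polynomial: p(z) |-> p(t) is well defined since p(z) = 0
    forces the minimal polynomial to divide p. *)
Lemma finField_embedding (E : fieldExtType F) :
  exists j : {rmorphism E -> K}, forall a, j (in_alg E a) = iota a.
Proof.
have [z genz] : exists z : E, <<1; z>>%VS = {:E}%VS.
  have gen (L : splittingFieldType F) : exists z : L, <<1; z>>%VS = {:L}%VS.
    have /and3P[_ sepL _] : galois 1 {:L} := finField_galois (sub1v _).
    exists (separable_generator 1 {:L}).
    by rewrite -eq_adjoin_separable_generator ?sub1v.
  exact: (gen (FinSplittingFieldType F E)).
have polyz y : exists p : {poly F}, y = (map_poly (in_alg E) p).[z].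
  have /Fadjoin_polyP[p /polyOver1P[r ->] yE] : y \in <<1;
    z>>%VS by rewrite genz memvf.
  by exists r.
have [mp mpE] : exists p, minPoly 1 z = map_poly (in_alg E) p.
  by apply/polyOver1P/minPolyOver.
have [t mpt] : exists t, root (map_poly iota mp) t.
  apply/closed_rootP; rewrite size_map_poly -(size_map_poly (in_alg E)) -mpE.
  by rewrite size_minPoly.
have ker (p : {poly F}) : (map_poly (in_alg E) p).[z] = 0 ->
  (map_poly iota p).[t] = 0.
  move=> pz; have /dvdpP[d ->] : mp %| p.
    by rewrite -(dvdp_map (in_alg E)) -mpE minPoly_dvdp ?alg_polyOver //;
      apply/rootP.
  by rewrite rmorphM hornerM (rootP mpt) mulr0.
have [r rE] := choice polyz.
pose j y := (map_poly iota (r y)).[t].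
have jE p y : y = (map_poly (in_alg E) p).[z] -> j y = (map_poly iota p).[t].
  move=> yE; apply/eqP; rewrite -subr_eq0 -hornerN -hornerD -rmorphB ker //.
  by rewrite rmorphB hornerD hornerN -rE -yE subrr.
have jB : zmod_morphism j.
  move=> x y; rewrite -hornerN -hornerD -rmorphB; apply: jE.
  by rewrite rmorphB hornerD hornerN -!rE.
have jM : monoid_morphism j.
  split=> [|x y]; first by rewrite (jE 1) ?rmorph1 ?hornerC.
  by rewrite -hornerM -rmorphM; apply: jE; rewrite rmorphM hornerM -!rE.
pose jj : {rmorphism E -> K} :=
  HB.pack j (GRing.isZmodMorphism.Build _ _ j jB)
    (GRing.isMonoidMorphism.Build _ _ j jM).
by exists jj => a; rewrite -[LHS]/(j _) (jE a%:P) map_polyC hornerC.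
Qed.

End Embedding.

(** * Algebras and their structure constants *)

Section StructureConstants.

Lemma mxvec_mulE (R : comNzRingType) m n p (X : 'M[R]_(m, n))
  (M : 'M_(m * n, p)) k :
  (mxvec X *m M) 0 k = \sum_i \sum_j X i j * M (mxvec_index i j) k.
Proof.
rewrite mxE (reindex _ (curry_mxvec_bij m n)) pair_bigA /=.
by apply: eq_bigr => -[i j] _ /=; rewrite mxvecE.
Qed.

Lemma mx_mulP (R : comNzRingType) n (C D : 'M[R]_(n * n, n)) (g : 'M_n) :
  C *m g = tens g *m D <->
  forall x y : 'rV_n, mxvec (x^T *m y) *m C *m g =
    mxvec ((x *m g)^T *m (y *m g)) *m D.
Proof.
split=> [Cg x y|mulg].
  by rewrite -mulmxA Cg mulmxA mxvec_tens trmx_mul !mulmxA.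
apply/row_matrixP=> u; rewrite !rowE; case/mxvec_indexP: u => i j.
rewrite -mxvec_delta -(mul_delta_mx (0 : 'I_1)) -[delta_mx i 0]trmx_delta.
by rewrite !mulmxA mulg mxvec_tens trmx_mul !mulmxA.
Qed.

Lemma lin_bij_mx (R : fieldType) n n' (h : 'rV[R]_n -> 'rV[R]_n') :
    linear h -> bijective h ->
  exists (g : 'M_(n, n')) (g' : 'M_(n', n)),
    [/\ g *m g' = 1%:M, g' *m g = 1%:M & forall v, h v = v *m g].
Proof.
move=> hl [h' hK h'K].
have h'l : linear h' by move=> a u v; apply: (canLR hK); rewrite hl !h'K.
pose H : {linear 'rV[R]_n -> 'rV[R]_n'} :=
  HB.pack h (GRing.isLinear.Build _ _ _ _ h hl).
pose H' : {linear 'rV[R]_n' -> 'rV[R]_n} :=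
  HB.pack h' (GRing.isLinear.Build _ _ _ _ h' h'l).
exists (lin1_mx H), (lin1_mx H'); split=> [||v]; last by rewrite mul_rV_lin1.
  by apply/row_matrixP=> i; rewrite !rowE mulmx1 mulmxA !mul_rV_lin1 /= hK.
by apply/row_matrixP=> i; rewrite !rowE mulmx1 mulmxA !mul_rV_lin1 /= h'K.
Qed.

(** The image of the unit is a unit for all products with elements of the image,
    that is, with all elements. *)
Lemma bij_mul_aone (F : fieldType) (A B : fdalgType F) (f : A -> B) :
  {morph f : x y / amul x y} -> bijective f -> f aone = aone.
Proof.
by move=> fM [f' _ f'K];
  rewrite -[LHS]amul1r -[X in amul _ X]f'K -fM amul1l f'K.
Qed.

(** Coordinates on A in which the product is the one encoded by C.  The dimension
    n is a parameter, rather than \dim {: A}, so that it can be replaced by an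
    equal number. *)
Definition represents (F : fieldType) (A : fdalgType F) n
    (C : 'M[F]_(n * n, n)) :=
  exists c : A -> 'rV[F]_n, [/\ linear c, bijective c &
    forall x y, c (amul x y) = mxvec ((c x)^T *m c y) *m C].

Definition str_mx (F : fieldType) (A : fdalgType F) :
  'M[F]_(\dim {: A} * \dim {: A}, \dim {: A}) :=
  \matrix_(u, k) mxvec (\matrix_(i, j)
    coord (vbasis {: A}) k (amul (vbasis {: A})`_i (vbasis {: A})`_j)) 0 u.

Lemma str_mxE (F : fieldType) (A : fdalgType F) i j k :
  str_mx A (mxvec_index i j) k =
    coord (vbasis {: A}) k (amul (vbasis {: A})`_i (vbasis {: A})`_j).
Proof. by rewrite mxE mxvecE mxE. Qed.

Lemma str_mx_represents (F : fieldType) (A : fdalgType F) :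
  represents A (str_mx A).
Proof.
pose e := vbasis {: A}; pose c (x : A) := \row_k coord e k x.
exists c; split=> [a x y||x y].
- by apply/rowP=> k; rewrite !mxE linearP.
- exists (fun v : 'rV_(\dim {: A}) => \sum_i v 0 i *: e`_i) => [x|v].
    by rewrite [RHS](coord_vbasis (memvf x)); apply: eq_bigr => i _;
      rewrite mxE.
  apply/rowP=> k; rewrite mxE linear_sum (bigD1 k) //= big1 => [|i ik].
    by rewrite linearZ /=
      coord_free ?eqxx ?mulr1 ?addr0 // (basis_free (vbasisP _)).
  by rewrite linearZ /=
    coord_free ?(negPf ik) ?mulr0 // (basis_free (vbasisP _)).
- apply/rowP=> k; rewrite mxvec_mulE mxE.
  rewrite {1}(coord_vbasis (memvf x)) {1}(coord_vbasis (memvf y)) amul_suml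
    linear_sum.
  apply: eq_bigr => i _; rewrite amulZl amul_sumr scaler_sumr linear_sum.
  apply: eq_bigr => j _; rewrite amulZr !linearZ /= str_mxE mulrA;
    congr (_ * _).
  by rewrite !mxE big_ord1 !mxE.
Qed.

Lemma base_change_amulE (F L : fieldType) (iota : {rmorphism F -> L})
    (A : fdalgType F) (x y : base_change iota A) :
  amul x y = mxvec ((x : 'rV_(\dim {: A}))^T *m (y : 'rV_(\dim {: A})))
    *m map_mx iota (str_mx A)
    :> 'rV[L]_(\dim {: A}).
Proof.
apply/rowP=> k;
  rewrite mxvec_mulE [amul x y]/(base_change_mul x y) /base_change_mul.
rewrite summxE; apply: eq_bigr => i _; rewrite summxE; apply: eq_bigr => j _.
by rewrite mxE [map_mx _ _ _ _]mxE str_mxE mxE [in RHS]mxE big_ord1 mxE.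
Qed.

Lemma base_change_represents (F L : fieldType) (iota : {rmorphism F -> L})
  (A : fdalgType F) :
  represents (base_change iota A) (map_mx iota (str_mx A)).
Proof.
exists (fun x => x); split=> // [|x y]; first by exists id.
exact: base_change_amulE.
Qed.

Lemma castmx_represents (F : fieldType) (A : fdalgType F) n n' (e : n = n')
    (D : 'M[F]_(n' * n', n')) :
  represents A D ->
    represents A (castmx (congr2 muln (esym e) (esym e), esym e) D).
Proof. by case: _ / e D => D; rewrite castmx_id. Qed.

(** The cast accounts for the fact that the equality of the dimensions of A and B
    is itself a consequence of the isomorphism. *)
Lemma iso_mx_of_alg (F : fieldType) (A B : fdalgType F) n n'
    (C : 'M[F]_(n * n, n)) (D : 'M[F]_(n' * n', n')) :
    represents A C -> represents B D -> alg_isomorphic A B ->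
  exists e : n = n', exists g,
    mx_iso C (castmx (congr2 muln (esym e) (esym e), esym e) D) g.
Proof.
move=> [c [cl [c' cK c'K] cM]] [d [dl dbij dM]] [f [[fl _ fM] fbij]].
have c'l : linear c' by move=> a u v; apply: (canLR cK); rewrite cl !c'K.
have [|//|g [g' [gg' g'g hE]]] := @lin_bij_mx F n n' (d \o f \o c').
- by move=> a u v /=; rewrite c'l fl dl.
- by apply: bij_comp (bij_comp dbij fbij) _; exists c.
have e : n = n'.
  by apply/eqP; rewrite eqn_leq (mulmx1_min gg') (mulmx1_min g'g).
exists e;
  case: _ / e D d dl dbij dM g g' gg' g'g hE => D d dl dbij dM g g' gg' g'g hE.
exists g; rewrite castmx_id /mx_iso (proj1 (mulmx1_unit gg')) /=.
apply/eqP/mx_mulP => x y.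
rewrite -!hE /= -dM -fM; congr (d (f _)); apply: (canLR cK).
by rewrite cM !c'K.
Qed.

Lemma alg_of_iso_mx (F : fieldType) (A B : fdalgType F) n
  (C D : 'M[F]_(n * n, n)) g :
    represents A C -> represents B D -> mx_iso C D g -> alg_isomorphic A B.
Proof.
move=> [c [cl cbij cM]] [d [dl [d' dK d'K] dM]] /andP[gU /eqP /mx_mulP mulg].
have d'l : linear d' by move=> a u v; apply: (canLR dK); rewrite dl !d'K.
pose f x := d' (c x *m g).
have fM : {morph f : x y / amul x y}.
  by move=> x y; apply: (canLR dK); rewrite dM !d'K cM mulg.
have fbij : bijective f.
  apply: bij_comp; first by exists d.
  apply: (@bij_comp _ _ _ (mulmxr g)) cbij.
  by exists (mulmxr (invmx g)) => x /=; rewrite ?mulmxK ?mulmxKV.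
exists f; split=> //; split=> //; last exact: bij_mul_aone.
by move=> a x y; rewrite /f cl mulmxDl -scalemxAl d'l.
Qed.

Lemma Aut_mxE (F : finFieldType) (K : closedFieldType)
    (iota : {rmorphism F -> K}) (A : fdalgType F) :
  Aut iota A = aut_set iota (str_mx A).
Proof.
rewrite /Aut /aut_set; congr image; apply/seteqP; split=> g /=.
  move=> [gU mulg _]; rewrite /mx_iso gU; apply/eqP/mx_mulP => x y.
  by have := mulg x y; rewrite !base_change_amulE.
move=> /andP[gU /eqP /mx_mulP mulg]; have gM (x y : base_change iota A) :
    amul x y *m g =
      amul (x *m g : base_change iota A) (y *m g : base_change iota A).
  by rewrite !base_change_amulE; apply: mulg.
split=> //;
  apply: (@bij_mul_aone _ (base_change iota A) (base_change iota A) (mulmxr g))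
  => //.
by exists (mulmxr (invmx g)) => x /=; rewrite ?mulmxK ?mulmxKV.
Qed.

End StructureConstants.

Theorem proposition7p4 (F : finFieldType)
    (* an algebraic closure of F *)
    (K : closedFieldType) (iota : {rmorphism F -> K})
    (iota_alg : integralRange iota)
    (A B : fdalgType F) (m : nat) (m_gt0 : (0 < m)%N)
    (* the extension of F of degree m *)
    (E : fieldExtType F) (dimE : \dim {: E} = m) :
  coprime m (num_components iota A)`! ->
  alg_isomorphic (base_change (in_alg E) A) (base_change (in_alg E) B) ->
  alg_isomorphic A B.
Proof.
rewrite /num_components Aut_mxE => co isoE.
have [phi phiE] := frobenius_ex iota.
have [j jE] := finField_embedding iota E.
have [e [u iso_u]] := iso_mx_of_alg (base_change_represents (in_alg E) A)
  (base_change_represents (in_alg E) B) isoE.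
have [D repD iso_uD] : exists2 D, represents B D &
    mx_iso (map_mx (in_alg E) (str_mx A)) (map_mx (in_alg E) D) u.
  exists (castmx (congr2 muln (esym e) (esym e), esym e) (str_mx B));
    last first.
    by rewrite map_castmx.
  exact/castmx_represents/str_mx_represents.
have [||g iso_g] := @descent F K iota phi phiE _ (str_mx A) D
  (map_mx j (invmx u)) m _ m_gt0 _ co.
- have := map_mx_iso j (mx_iso_inv iso_uD).
  by rewrite -!map_mx_comp !(eq_map_mx _ jE).
- (* phi^m is the identity on the image of E, which has q ^ m elements. *)
  have iterE k (M : 'M[K]_(\dim {: A})) : iter k (map_mx phi) M =
    map_mx (fun x => x ^+ (#|F| ^ k)) M.
    elim: k => [|k IH] /=; apply/matrixP=> r s; first by rewrite mxE expr1.
    by rewrite IH !mxE phiE -exprM -expnSr.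
  rewrite iterE -dimE; apply/matrixP=> r s; rewrite !mxE -rmorphXn /=.
  by have := memvf (invmx u r s); rewrite Fermat's_little_theorem => /eqP->.
exact: alg_of_iso_mx (str_mx_represents A) repD (mx_iso_inv iso_g).
Qed.
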